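(* Let $X(t)$, $t\in\mathbb R^m$, be a scalar ergodic homogeneous random field over $(\Omega_X,\mathcal F_X,P_X)$, jointly measurable in $(t,\omega)$, with $X(t)\in(0,1)$ almost surely, and such that the distribution function $F$ of $X(0)$ is continuous. Let $\{T_n\}$ be a pointwise averaging sequence of sets in $\mathbb R^m$, $k_n\in\mathbb N$, $k_n\uparrow\infty$, and for each $n$ let $\tau_{n,1},\dots,\tau_{n,k_n}$ be i.i.d. points uniformly distributed on $T_n$, independent of $X$. For $y\in[0,1]$ put $F_n(y)=\frac1{k_n}\sum_{i=1}^{k_n}\mathbf 1_{[0,y]}(X(\tau_{n,i}))$ and $M_n(y)=\frac1{\lambda(T_n)}\int_{T_n}\mathbf 1_{[0,y]}(X(s))\lambda(ds)$, and assume that $\sqrt{k_n}\,\sup_{y\in[0,1]}|M_n(y)-F(y)|\to0$ in probability. Then for every $x>0$, as $n\to\infty$, $$P_{X,\tau}\Big\{\sup_{y}\big|k_n^{1/2}(F_n(y)-F(y))\big|\le x\Big\}\to\sum_{k=-\infty}^{\infty}(-1)^ke^{-2k^2x^2}.$$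
   Context: $\lambda$ is Lebesgue measure on $\mathbb R^m$. A field is homogeneous if its finite-dimensional distributions are shift-invariant. For a homogeneous field $Y$ on $\mathbb R^m$, $\mathcal I_Y$ is the $\sigma$-field of events $\{Y\in A\}$ ($A$ in the product $\sigma$-field of the space of functions on $\mathbb R^m$) with $P(\{Y\in A\}\triangle\{Y(\cdot+t)\in A\})=0$ for all $t$; $Y$ is ergodic if $\mathcal I_Y$ contains only events of probability $0$ or $1$. A sequence $\{T_n\}$ of bounded Borel sets with $\lambda(T_n)>0$, $\lambda(T_n)\to\infty$, is pointwise averaging if for every jointly measurable scalar homogeneous random field $Y$ on $\mathbb R^m$ and every measurable $f:\mathbb R\to\mathbb R$ with $E|f(Y(0))|<\infty$, almost surely $\frac1{\lambda(T_n)}\int_{T_n}f(Y(t))\lambda(dt)\to E[f(Y(0))\mid\mathcal I_Y]$. The $\tau_{n,i}$ live on $(\Omega_\tau,\mathcal F_\tau,P_\tau)$ and $P_{X,\tau}:=P_X\times P_\tau$. The supremum over $y$ is over $[0,1]$. *)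

(* Defs.v *)
From HB Require Import structures.
From mathcomp Require Import all_boot all_order all_algebra.
From mathcomp Require Import all_classical all_reals all_analysis.

Set Implicit Arguments.
Unset Strict Implicit.
Unset Printing Implicit Defensive.

Import Order.TTheory GRing.Theory Num.Theory.
Import numFieldNormedType.Exports.

Local Open Scope classical_set_scope.
Local Open Scope ring_scope.

(* R^m is [m.-tuple R], whose canonical measurable structure is the product
   (= Borel) sigma-algebra. *)

Definition tuple_add (R : realType) (m : nat) (s t : m.-tuple R) : m.-tuple R :=
  [tuple tnth s i + tnth t i | i < m].

Definition tuple_zero (R : realType) (m : nat) : m.-tuple R := [tuple 0 | _ < m].

Definition tuple_bounded (R : realType) (m : nat) (D : set (m.-tuple R)) :=
  exists M : R, forall t, D t -> forall i, `|tnth t i| <= M.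

Section lebesgue_tuple.
Local Open Scope ereal_scope.
Context (R : realType).

Definition tuple_consp (n : nat) (p : measurableTypeR R * n.-tuple R) :
  n.+1.-tuple R := [tuple of (p.1 : R) :: p.2].

Lemma measurable_tuple_consp n : measurable_fun setT (@tuple_consp n).
Proof.
apply: (@measurable_cons _ _ _ _ (fun p => p.1 : R) n snd) => //.
exact: measurable_fst.
Qed.

Section step.
Context (n : nat) (mu : {sigma_finite_measure set (n.-tuple R) -> \bar R}).

(* The image of (Lebesgue measure on R) x mu under (x, s) |-> x :: s. *)
Definition lebesgue_cons : set (n.+1.-tuple R) -> \bar R :=
  pushforward ((@lebesgue_measure R) \x mu) (@tuple_consp n).

Let lebesgue_cons0 : lebesgue_cons set0 = 0.
Proof. by rewrite /lebesgue_cons /pushforward preimage_set0 measure0. Qed.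

Let lebesgue_cons_ge0 A : 0 <= lebesgue_cons A.
Proof. by rewrite /lebesgue_cons /pushforward; exact: measure_ge0. Qed.

Let lebesgue_cons_sigma_additive : semi_sigma_additive lebesgue_cons.
Proof.
move=> F mF tF mUF; rewrite /lebesgue_cons /pushforward preimage_bigcup.
apply: measure_semi_sigma_additive.
- move=> k; rewrite -[X in measurable X]setTI.
  exact: measurable_tuple_consp.
- apply/trivIsetP => i j _ _ ij; rewrite -preimage_setI.
  by move/trivIsetP : tF => /(_ _ _ _ _ ij) ->//; rewrite preimage_set0.
- rewrite -preimage_bigcup -[X in measurable X]setTI.
  exact: measurable_tuple_consp.
Qed.

HB.instance Definition _ := isMeasure.Build _ _ _ lebesgue_cons
  lebesgue_cons0 lebesgue_cons_ge0 lebesgue_cons_sigma_additive.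

Lemma lebesgue_consE (A : set R) (B : set (n.-tuple R)) :
  measurable A -> measurable B ->
  lebesgue_cons [set t | A (thead t) /\ B [tuple of behead t]] =
    lebesgue_measure A * mu B.
Proof.
move=> mA mB; rewrite -product_measure1E//.
rewrite /lebesgue_cons /pushforward; congr (_ _); apply/seteqP.
have beh (x : R) (s : n.-tuple R) : [tuple of behead [tuple of x :: s]] = s.
  exact/val_inj.
by split=> -[x s] /=; rewrite /tuple_consp theadE /= beh.
Qed.

Let lebesgue_cons_sigma_finite : sigma_finite setT lebesgue_cons.
Proof.
have /sigma_finiteP[F [TF ndF Foo]] := sigma_finiteT (@lebesgue_measure R).
have /sigma_finiteP[G [TG ndG Goo]] := sigma_finiteT mu.
exists (fun k => [set t | F k (thead t) /\ G k [tuple of behead t]]).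
  apply/seteqP; split=> // t _.
  have [i _ Fi] : (\bigcup_i F i) (thead t) by rewrite -TF.
  have [j _ Gj] : (\bigcup_i G i) [tuple of behead t] by rewrite -TG.
  exists (maxn i j) => //=; split.
  - by move: Fi; exact/subsetPset/ndF/leq_maxl.
  - by move: Gj; exact/subsetPset/ndG/leq_maxr.
move=> k; have [mF Fk] := Foo k; have [mG Gk] := Goo k; split.
  apply: measurableI.
  - rewrite -[X in measurable X]setTI.
    exact: (@measurable_tnth _ _ _ ord0).
  - rewrite -[X in measurable X]setTI; exact: measurable_behead.
by rewrite lebesgue_consE// lte_mul_pinfty// ge0_fin_numE.
Qed.

HB.instance Definition _ := @Measure_isSigmaFinite.Build _ _ _ lebesgue_cons
  lebesgue_cons_sigma_finite.

End step.

Fixpoint lebesgue_tuple (m : nat) :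
    {sigma_finite_measure set (m.-tuple R) -> \bar R} :=
  match m with
  | 0 => \d_([tuple] : 0.-tuple R)
  | n.+1 => lebesgue_cons (lebesgue_tuple n)
  end.

Lemma lebesgue_tuple_box m (A : 'I_m -> set R) :
  (forall i, measurable (A i)) ->
  lebesgue_tuple m [set t | forall i, A i (tnth t i)] =
    \prod_(i < m) lebesgue_measure (A i).
Proof.
elim: m => [|n IH] in A *; move=> mA /=.
  by rewrite big_ord0 diracE mem_set// => -[].
rewrite big_ord_recl -IH// -lebesgue_consE//; last first.
  rewrite (_ : [set _ | _] = \bigcap_(i in [set: 'I_n])
      ((fun t : n.-tuple R => tnth t i) @^-1` A (lift ord0 i))); last first.
    by apply/seteqP; split=> t /= H i; [move=> _|]; exact: H.
  apply: fin_bigcap_measurable => // i _.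
  by rewrite -[X in measurable X]setTI; exact: measurable_tnth.
congr (_ _); apply/seteqP; split=> t /=.
  move=> H; split=> [|i]; first exact: (H ord0).
  by have := H (lift ord0 i); rewrite [in tnth t _](tuple_eta t) tnthS.
move=> [H0 H] i; have [j ->|->] := unliftP ord0 i; last exact: H0.
by have := H j; rewrite [in tnth t _](tuple_eta t) tnthS.
Qed.

End lebesgue_tuple.

Section random_fields.
Context (R : realType) (m : nat).
Context (d : measure_display) (Omega : measurableType d) (P : probability Omega R).
Implicit Type Y : m.-tuple R -> {RV P >-> R}.

Definition jointly_measurable Y :=
  measurable_fun setT (fun p : m.-tuple R * Omega => Y p.1 p.2).

Definition homogeneous Y :=
  forall (j : nat) (t : 'I_j -> m.-tuple R) (h : m.-tuple R)
         (B : set (j.-tuple R)), measurable B ->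
    P [set w | B [tuple Y (tuple_add (t i) h) w | i < j]] =
    P [set w | B [tuple Y (t i) w | i < j]].

Definition product_sigma_field : set (set (m.-tuple R -> R)) :=
  <<s \bigcup_t preimage_set_system setT (fun g : m.-tuple R -> R => g t)
        (measurable : set (set R)) >>.

Definition field_event Y (A : set (m.-tuple R -> R)) : set Omega :=
  [set w | A (fun t => Y t w)].

Definition shifted_field Y (h : m.-tuple R) : m.-tuple R -> {RV P >-> R} :=
  fun t => Y (tuple_add t h).

Definition invariant_events Y : set (set Omega) :=
  [set E | exists A, [/\ product_sigma_field A, E = field_event Y A &
     forall h, P (E `+` field_event (shifted_field Y h) A) = 0%E]].

Definition ergodic Y :=
  forall E, invariant_events Y E -> P E = 0%E \/ P E = 1%E.

(* Z is a version of E[V | G], for a sub-sigma-field G. *)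
Definition is_cond_expectation (G : set (set Omega)) (V Z : Omega -> R) :=
  [/\ forall B, measurable B -> G (Z @^-1` B),
      P.-integrable setT (EFin \o Z) &
      forall E, G E -> (\int[P]_(w in E) (Z w)%:E = \int[P]_(w in E) (V w)%:E)%E].

End random_fields.

Section spatial_averages.
Context (R : realType) (m : nat).

Definition spatial_average (D : set (m.-tuple R)) (g : m.-tuple R -> R) : R :=
  (fine (lebesgue_tuple R m D))^-1 * \int[lebesgue_tuple R m]_(t in D) g t.

(* The limit is required to be every version Z of E[f(Y(0)) | I_Y]; versions
   exist and agree almost surely. *)
Definition pointwise_averaging (T : nat -> set (m.-tuple R)) :=
  [/\ forall n, measurable (T n) /\ tuple_bounded (T n),
      forall n, (0 < lebesgue_tuple R m (T n))%E,
      lebesgue_tuple R m (T n) @[n --> \oo] --> +oo%E &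
      forall (d : measure_display) (Omega : measurableType d)
             (P : probability Omega R) (Y : m.-tuple R -> {RV P >-> R}),
        jointly_measurable Y -> homogeneous Y ->
        forall f : R -> R, measurable_fun setT f ->
          P.-integrable setT (fun w => (f (Y (tuple_zero R m) w))%:E) ->
        forall Z : Omega -> R,
          is_cond_expectation P (invariant_events Y)
            (fun w => f (Y (tuple_zero R m) w)) Z ->
        {ae P, forall w,
          spatial_average (T n) (fun t => f (Y t w)) @[n --> \oo] --> Z w}].

End spatial_averages.

Definition mutually_independent (R : realType) (d d' : measure_display)
    (Omega : measurableType d) (T' : measurableType d') (P : probability Omega R)
    (I : finType) (Z : I -> {RV P >-> T'}) :=
  forall (J : {set I}) (B : I -> set T'), (forall i, measurable (B i)) ->
    P (\bigcap_(i in [set` J]) (Z i @^-1` B i)) =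
    (\prod_(i in J) P (Z i @^-1` B i))%E.

Definition uniformly_distributed (R : realType) (m : nat) (d : measure_display)
    (Omega : measurableType d) (P : probability Omega R)
    (D : set (m.-tuple R)) (Z : {RV P >-> (m.-tuple R)}) :=
  forall B, measurable B ->
    distribution P Z B =
    (((fine (lebesgue_tuple R m D))^-1)%:E * lebesgue_tuple R m (B `&` D))%E.

Definition cvg_to_zero_in_probability (R : realType) (d : measure_display)
    (Omega : measurableType d) (P : probability Omega R) (Z : nat -> Omega -> R) :=
  forall e : R, 0 < e -> P [set w | e <= `|Z n w|] @[n --> \oo] --> 0%E.

Definition sup01 (R : realType) (g : R -> R) : R := sup (g @` `[0, 1]).

Definition empirical_cdf (R : realType) (k : nat) (z : 'I_k -> R) (y : R) : R :=
  k%:R^-1 * \sum_(i < k) \1_(`[0, y]%classic) (z i).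

(* The sum over k >= 0 plus the sum over k < 0 (Negz j is - (j + 1)); each half
   is the limit of its partial sums, meaningful when both halves converge. *)
Definition two_sided_series (R : realType) (a : int -> R) : R :=
  limn (series (fun j => a (Posz j))) + limn (series (fun j => a (Negz j))).

(* Main.v *)
(** Fix the path [w] of the field. Its values at the random points are then i.i.d., and the
    probability that such a value falls in [[0, y]] is [M_n(w, y)], which outside an event of
    small probability is [o(k_n^(-1/2))]-close to the continuous [F]; hence all atoms are
    [o(k_n^(-1/2))]. So it suffices to prove Kolmogorov's limit theorem uniformly over all
    discrete laws with small atoms.

    For the latter, tilting the distribution of a sample point by the factor [1 + t / sqrt n]
    on the first cells gives likelihood ratios which are exact martingales, close to the
    exponential martingales [exp (t z / s - t ^ 2 p / (2 s))], with [s = 1 - p], of the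
    Brownian bridge. The alternating combination of those with parameters [2 k x] given by
    the method of images starts from a partial sum of Kolmogorov's series, almost vanishes
    when the empirical process leaves [[-x, x]], and is close to [1] shortly before the final
    time; optional stopping at the first exit then yields the limit. *)

Require Import Defs.
From HB Require Import structures.
From mathcomp Require Import all_boot all_order all_algebra.
From mathcomp Require Import all_classical all_reals all_analysis.
From mathcomp Require Import measurable_realfun ring lra zify.

Set Implicit Arguments.
Unset Strict Implicit.
Unset Printing Implicit Defensive.
Import Order.TTheory GRing.Theory Num.Theory.
Import numFieldNormedType.Exports.

Local Open Scope classical_set_scope.
Local Open Scope ring_scope.

(** The conditional laws change with the path and with [n], so no single limit law is sampled.
    Likelihood ratios of finite product weights give bounds explicit in [n], and hence uniform in
    the law.

    Three obstacles shape the estimates. The process may jump beyond [x] at its exit; but a cell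
    receives [7 eta sqrt n] points or more only with probability exponentially small in [sqrt n],
    which survives both the tilting and a union bound over the [O(n)] levels. The exponents contain
    [1 / s], which explodes at the final time; so the martingales are stopped while the remaining
    mass [s] lies between [a / 2] and [a], and the rest of the path, read backwards, is a short
    initial piece governed by a maximal inequality. Finally, with [K] pairs of images the
    cancellation at the boundary leaves one image of size [exp(- 2 K (K + 1) x^2 / s)], small for
    large [K].

    Since each bound involves constants growing with the earlier choices, the parameters are fixed
    in the order [K], [t], [a], [eta], [n]. *)

(** * Expansion of logarithmic likelihood ratios *)

Lemma ln1D_taylor2 (R : realType) (u : R) : `|u| <= 2^-1 ->
  `|ln (1 + u) - (u - u ^+ 2 / 2)| <= 2 * `|u| ^+ 3.
Proof.
move=> u2; have /andP[ul uh] : - 2^-1 <= u <= 2^-1 by rewrite -ler_norml.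
pose g (v : R) : R := ln (1 + v) - (v - v ^+ 2 / 2).
(* The derivative of the remainder [g]. As [1 + v >= 1/2], it is at most [2 v^2], and the mean value
   theorem between [0] and [u] concludes. *)
pose dg (v : R) : R := v ^+ 2 / (1 + v).
have gd (v : R) : - 2^-1 <= v -> is_derive v 1 g (dg v).
  move=> hv; have v0 : 0 < 1 + v by lra.
  have := is_derive1_ln v0 => H.
  have H2 : is_derive v (1 : R) (fun v : R => 1 + v) 1.
    have -> : (fun v : R => 1 + v) = cst 1 + id by [].
    by apply: is_derive_eq; rewrite add0r.
  have H3 := @is_derive1_comp R (@ln R) (fun v : R => 1 + v) v _ _ H H2.
  have -> : g = (@ln R \o (fun v => 1 + v)) - (id - 2^-1 *: (id ^+ 2)).
    by apply/funext => w; rewrite /g !fctE /GRing.scale /= (mulrC _ 2^-1).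
  apply: is_derive_eq.
  rewrite /dg /GRing.scale /= expr1.
  field; lra.
have gc (a b : R) : - 2^-1 <= a -> {within `[a, b], continuous g}.
  move=> ha; apply: derivable_within_continuous => v; rewrite in_itv/= => /andP[av _].
  by have [] := gd v (le_trans ha av).
have g0 : g 0 = 0 by rewrite /g addr0 ln1; lra.
have key (c : R) : - 2^-1 <= c -> `|c| <= `|u| -> `|dg c * u| <= 2 * `|u| ^+ 3.
  move=> hc cu; rewrite /dg normrM normrM normrX normfV (exprSr _ 2) mulrA.
  apply: ler_wpM2r => //; rewrite mulrC (ger0_norm (_ : 0 <= 1 + c)); last by lra.
  apply: ler_pM => //; first by rewrite invr_ge0; lra.
    by rewrite -[leRHS]invrK lef_pV2 ?posrE; lra.
  by rewrite lerXn2r// nnegrE.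
rewrite -/(g u); have [u0|u0] := leP 0 u.
- have [c] := MVT_segment u0 (fun v (hv : v \in `]0, u[) =>
    gd v (ltac:(move: hv; rewrite in_itv /= => /andP[? ?]; lra)))
    (gc 0 u (ltac:(lra))).
  rewrite in_itv /= g0 !subr0 => /andP[c0 cu] ->.
  by apply: key; [lra|rewrite !ger0_norm].
- have [c] := MVT_segment (ltW u0) (fun v (hv : v \in `]u, 0[) =>
    gd v (ltac:(move: hv; rewrite in_itv /= => /andP[? ?]; lra)))
    (gc u 0 (ltac:(lra))).
  rewrite in_itv /= g0 sub0r sub0r mulrN => /andP[c0 cu] /oppr_inj ->.
  by apply: key; [lra|rewrite !ler0_norm ?lerN2 // ltW].
Qed.

(** Convexity: the graph of [expR] lies above its tangent at the larger point. *)
Lemma ler_dist_expR (R : realType) (a b M : R) : a <= M -> b <= M ->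
  `|expR a - expR b| <= `|a - b| * expR M.
Proof.
wlog ab : a b / b <= a.
  move=> H aM bM; have [ba|/ltW ab] := leP b a; first exact: H.
  by rewrite distrC (distrC a); exact: H.
move=> aM bM; rewrite !ger0_norm ?subr_ge0 ?ler_expR//.
apply: (@le_trans _ _ ((a - b) * expR a)); last first.
  by apply: ler_wpM2l; rewrite ?subr_ge0 ?ler_expR.
have -> : expR b = expR a * expR (b - a) by rewrite -expRD addrC subrK.
rewrite -{1}[expR a]mulr1 -mulrBr mulrC; apply: ler_wpM2r; first exact: expR_ge0.
by have := expR_ge1Dx (b - a); lra.
Qed.

(* The likelihood ratio is that of tilting the success probability [p] by the
   factor [1 + t / sqrt n]; its logarithm is that of the Brownian bridge's
   exponential martingale up to [O(n^-1/2)]. *)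
Lemma likelihood_ratio_approx (R : realType) (n N : nat) (p s t e Z z : R) :
  (0 < n)%N -> (N <= n)%N -> 0 <= p -> s = 1 - p -> 0 < e -> e <= s ->
  z = (N%:R - n%:R * p) / Num.sqrt n%:R -> `|z| <= Z ->
  2 * (`|t| / e) <= Num.sqrt n%:R ->
  exists2 d : R, `|d| <= (4 * (`|t| / e) ^+ 3 + Z * (`|t| / e) ^+ 2) / Num.sqrt n%:R &
    (1 + t / Num.sqrt n%:R) ^+ N * (1 - t / Num.sqrt n%:R * p / s) ^+ (n - N) =
    expR (t * z / s - t ^+ 2 * p / (2 * s) + d).
Proof.
move=> n0 Nn p0 sE e0 es zE zZ tn.
set r := Num.sqrt n%:R in zE tn *.
have r0 : 0 < r by rewrite sqrtr_gt0 ltr0n.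
have rr : r ^+ 2 = n%:R by rewrite sqr_sqrtr.
have s0 : 0 < s by exact: lt_le_trans es.
have s1 : s <= 1 by lra.
set B := `|t| / e in tn *.
have B0 : 0 <= B by rewrite divr_ge0 // ltW.
pose u := t / r; pose v := - (t / r * p / s).
have tB : `|t| <= B.
  rewrite /B ler_pdivlMr//; apply: ler_piMr => //; lra.
have uB : `|u| <= B / r.
  by rewrite /u normrM normfV (gtr0_norm r0) ler_pM2r ?invr_gt0.
have vB : `|v| <= B / r.
  rewrite /v normrN !normrM !normfV (gtr0_norm r0) (gtr0_norm s0) (ger0_norm p0).
  have -> : `|t| / r * p / s = (`|t| / s * p) / r by field; rewrite !gt_eqF.
  rewrite ler_pM2r ?invr_gt0// /B; apply: (@le_trans _ _ (`|t| / s)).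
    by apply: ler_piMr; [rewrite divr_ge0// ltW|lra].
  by apply: ler_wpM2l => //; rewrite lef_pV2.
have Br : B / r <= 2^-1 by rewrite ler_pdivrMr//; lra.
have u2 := le_trans uB Br; have v2 := le_trans vB Br.
have u1 : 0 < 1 + u by move: u2; rewrite ler_norml => /andP[]; lra.
have v1 : 0 < 1 + v by move: v2; rewrite ler_norml => /andP[]; lra.
pose d1 := ln (1 + u) - (u - u ^+ 2 / 2); pose d2 := ln (1 + v) - (v - v ^+ 2 / 2).
have d1B : `|d1| <= 2 * (B / r) ^+ 3.
  apply: le_trans (ln1D_taylor2 u2) _; rewrite ler_pM2l//.
  by rewrite lerXn2r// nnegrE// divr_ge0// ltW.
have d2B : `|d2| <= 2 * (B / r) ^+ 3.
  apply: le_trans (ln1D_taylor2 v2) _; rewrite ler_pM2l//.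
  by rewrite lerXn2r// nnegrE// divr_ge0// ltW.
have NE : N%:R = r ^+ 2 * p + z * r :> R.
  by rewrite zE rr -mulrA mulVf ?mulr1 ?gt_eqF//; lra.
have NE' : (n - N)%:R = r ^+ 2 * s - z * r :> R.
  by rewrite natrB// NE sE rr; lra.
(* The error [d] collects the cubic remainders, each at most [n] times [2 (B / r)^3], and the cost
   of replacing the counts by their means [n p] and [n s] in the quadratic part. In the linear part
   the means cancel and leave [t z / s]. *)
exists (N%:R * d1 + (n - N)%:R * d2 - z * r * (u ^+ 2 - v ^+ 2) / 2).
  have Nr : `|N%:R| <= r ^+ 2 by rewrite rr normr_nat ler_nat.
  have Nr' : `|(n - N)%:R| <= r ^+ 2 by rewrite rr normr_nat ler_nat leq_subr.
  have Z0 : 0 <= Z by exact: le_trans zZ.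
  have -> : (4 * B ^+ 3 + Z * B ^+ 2) / r =
     r ^+ 2 * (2 * (B / r) ^+ 3) + r ^+ 2 * (2 * (B / r) ^+ 3)
     + Z * r * ((B / r) ^+ 2 + (B / r) ^+ 2) / 2.
    by field; rewrite gt_eqF.
  apply: le_trans (ler_normB _ _) _; apply: lerD.
    by apply: le_trans (ler_normD _ _) _; rewrite !normrM; apply: lerD; apply: ler_pM.
  rewrite !normrM (gtr0_norm r0) normfV (@ger0_norm _ 2)// ler_pM2r ?invr_gt0//.
  apply: ler_pM; rewrite ?mulr_ge0// ?(ltW r0)//.
    by rewrite ler_pM2r.
  apply: le_trans (ler_normB _ _) _; rewrite !normrX.
  by apply: lerD; rewrite lerXn2r// nnegrE// divr_ge0// ltW.
have -> : 1 - t / r * p / s = 1 + v by rewrite /v.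
rewrite -(@lnK _ ((1 + u) ^+ N * _)); last by rewrite posrE mulr_gt0// exprn_gt0.
congr expR; rewrite lnM ?posrE ?exprn_gt0// !lnXn// -[ln (1 + u) *+ _]mulr_natl -[ln (1 + v) *+ _]mulr_natl.
have -> : ln (1 + u) = d1 + (u - u ^+ 2 / 2) by rewrite /d1 subrK.
have -> : ln (1 + v) = d2 + (v - v ^+ 2 / 2) by rewrite /d2 subrK.
have -> : t * z / s - t ^+ 2 * p / (2 * s) =
   N%:R * (u - u ^+ 2 / 2) + (n - N)%:R * (v - v ^+ 2 / 2)
   + z * r * (u ^+ 2 - v ^+ 2) / 2.
  rewrite NE NE' /v /u; have -> : p = 1 - s by lra.
  by field; rewrite !gt_eqF.
by lra.
Qed.

(** * Product weights and level counts *)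

Section product_expectation.
Variables (R : realType) (n : nat).

(** An i.i.d. sample is encoded by a product weight on finite functions. No normalisation is built
    in, so that tilting a law is a mere multiplication of weights. *)
Definition expect (S : finType) (f : S -> R) (G : {ffun 'I_n -> S} -> R) : R :=
  \sum_(c : {ffun 'I_n -> S}) (\prod_i f (c i)) * G c.

Section theory.
Variable S : finType.
Implicit Types (f : S -> R) (G : {ffun 'I_n -> S} -> R).

Lemma eq_expect f G G' : G =1 G' -> expect f G = expect f G'.
Proof. by move=> GG'; apply: eq_bigr => c _; rewrite GG'. Qed.

Lemma expectD f G G' : expect f (fun c => G c + G' c) = expect f G + expect f G'.
Proof. by rewrite -big_split/=; apply: eq_bigr => c _; rewrite mulrDr. Qed.

Lemma expectZ f G a : expect f (fun c => a * G c) = a * expect f G.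
Proof. by rewrite big_distrr/=; apply: eq_bigr => c _; rewrite mulrCA. Qed.

Lemma expectB f G G' : expect f (fun c => G c - G' c) = expect f G - expect f G'.
Proof.
by rewrite -[in RHS]mulN1r -expectZ -expectD; apply: eq_expect => c; rewrite mulN1r.
Qed.

Lemma expect_sum f (I : Type) (r : seq I) (P : pred I)
    (G : I -> {ffun 'I_n -> S} -> R) :
  expect f (fun c => \sum_(i <- r | P i) G i c) = \sum_(i <- r | P i) expect f (G i).
Proof.
by rewrite exchange_big/=; apply: eq_bigr => c _; rewrite big_distrr.
Qed.

Lemma le_expect f G G' : (forall s, 0 <= f s) -> (forall c, G c <= G' c) ->
  expect f G <= expect f G'.
Proof.
move=> f0 GG'; apply: ler_sum => c _; apply: ler_wpM2l => //.
by apply: prodr_ge0.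
Qed.

Lemma expect_prod f (g : S -> R) :
  expect f (fun c => \prod_i g (c i)) = (\sum_s f s * g s) ^+ n.
Proof.
transitivity (\prod_(i < n) \sum_s f s * g s); last first.
  by rewrite prodr_const card_ord.
by rewrite bigA_distr_bigA; apply: eq_bigr => c _; rewrite -big_split.
Qed.

Lemma expect_cst f a : \sum_s f s = 1 -> expect f (fun=> a) = a.
Proof.
move=> f1; have := expect_prod f (fun=> 1).
rewrite -big_distrl/= f1 mulr1 expr1n => H; rewrite -[RHS]mulr1 -[in RHS]H -expectZ.
by apply: eq_expect => c; rewrite prodr_const expr1n mulr1.
Qed.

(** Change of measure: a product likelihood is absorbed into the law of one sample point. *)
Lemma expect_tilt f (g : S -> R) G :
  expect (fun s => f s * g s) G = expect f (fun c => (\prod_i g (c i)) * G c).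
Proof. by apply: eq_bigr => c _; rewrite big_split/= mulrA. Qed.

Lemma ler_norm_expect f G : (forall s, 0 <= f s) ->
  `|expect f G| <= expect f (fun c => `|G c|).
Proof.
move=> f0; apply: le_trans (ler_norm_sum _ _ _) _.
by apply: ler_sum => c _; rewrite normrM ger0_norm// prodr_ge0.
Qed.

(** On the samples with a given image under [phi], [G] is constant and the product weight sums to a
    product of fibre masses, which are the same for [f] and [f']. *)
Lemma expect_eq_fibres (B : finType) (phi : S -> B) f f' G :
  (forall b, \sum_(s | phi s == b) f s = \sum_(s | phi s == b) f' s) ->
  (forall c c' : {ffun 'I_n -> S}, (forall i, phi (c i) = phi (c' i)) -> G c = G c') ->
  expect f G = expect f' G.
Proof.
move=> ff' GG'; pose im (c : {ffun 'I_n -> S}) : {ffun 'I_n -> B} := [ffun i => phi (c i)].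
rewrite /expect (partition_big im xpredT)//= [RHS](partition_big im xpredT)//=.
apply: eq_bigr => b _.
have [c0 /eqP c0b|none] := pickP (fun c => im c == b); last first.
  by rewrite !big_pred0.
have fam g : \sum_(c | im c == b) (\prod_i g (c i)) * G c =
    (\prod_i \sum_(s | phi s == b i) g s) * G c0.
  rewrite bigA_distr_big_dep big_distrl /=; apply: eq_big => [c|c /eqP cb].
    apply/eqP/familyP => [<- i|H]; first by rewrite unfold_in ffunE.
    by apply/ffunP => i; rewrite ffunE; have := H i; rewrite unfold_in => /eqP.
  congr (_ * _); apply: GG' => i; move: cb; rewrite -c0b => /ffunP/(_ i).
  by rewrite !ffunE.
by rewrite !fam; congr (_ * _); apply: eq_bigr => i _; exact: ff'.
Qed.

End theory.
End product_expectation.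

Section level_process.
Variables (R : realType) (n : nat) (S : finType) (lev : S -> nat).
Implicit Types (q : S -> R) (j : nat) (c : {ffun 'I_n -> S}).

Definition level_mass q j : R := \sum_(s | lev s == j) q s.

(** Levels play the role of time; this is the [p] of the exponential martingales. *)
Definition level_cdf q j : R := \sum_(s | (lev s <= j)%N) q s.

Definition level_count c j : nat := #|[pred i | (lev (c i) <= j)%N]|.

Definition level_jump c j : nat := #|[pred i | lev (c i) == j]|.

(** The factor [1 + u] up to level [j] forces the other one, which restores total mass one. *)
Definition tilt q (u : R) j s : R :=
  if (lev s <= j)%N then 1 + u else 1 - u * level_cdf q j / (1 - level_cdf q j).

Definition likelihood q u j c : R := \prod_i tilt q u j (c i).

Lemma level_count_le c j : (level_count c j <= n)%N.
Proof. by rewrite (leq_trans (max_card _))// card_ord. Qed.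

Lemma level_countS c j : level_count c j.+1 = (level_count c j + level_jump c j.+1)%N.
Proof.
rewrite /level_count /level_jump -!sum1_card.
rewrite (bigID (fun i => (lev (c i) <= j)%N))/=; congr addn; apply: eq_bigl => i;
  rewrite !inE; lia.
Qed.

Lemma level_count0 c : level_count c 0 = level_jump c 0.
Proof. by apply: eq_card => i; rewrite !inE leqn0. Qed.

Lemma level_cdfS q j : level_cdf q j.+1 = level_cdf q j + level_mass q j.+1.
Proof.
rewrite /level_cdf /level_mass (bigID (fun s => (lev s <= j)%N))/=.
by congr (_ + _); apply: eq_bigl => s; lia.
Qed.

Lemma level_cdf0 q : level_cdf q 0 = level_mass q 0.
Proof. by apply: eq_bigl => s; rewrite leqn0. Qed.

Lemma likelihoodE q u j c : likelihood q u j c =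
  (1 + u) ^+ level_count c j *
  (1 - u * level_cdf q j / (1 - level_cdf q j)) ^+ (n - level_count c j).
Proof.
rewrite /likelihood (bigID (fun i => (lev (c i) <= j)%N))/=; congr (_ * _).
  rewrite (eq_bigr (fun=> 1 + u)); last by move=> i; rewrite /tilt => ->.
  by rewrite prodr_const.
rewrite (eq_bigr (fun=> 1 - u * level_cdf q j / (1 - level_cdf q j))); last first.
  by move=> i; rewrite /tilt => /negPf ->.
rewrite prodr_const; congr (_ ^+ _).
have := cardC [pred i | (lev (c i) <= j)%N]; rewrite card_ord => H.
rewrite -[X in (X - _)%N]H addKn.
by apply: eq_card => i; rewrite !inE.
Qed.

Section probability_weight.
Variable q : S -> R.
Hypotheses (q0 : forall s, 0 <= q s) (q1 : \sum_s q s = 1).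

Lemma level_cdf_ge0 j : 0 <= level_cdf q j.
Proof. exact: sumr_ge0. Qed.

Lemma level_mass_ge0 j : 0 <= level_mass q j.
Proof. exact: sumr_ge0. Qed.

Lemma level_cdf_homo i j : (i <= j)%N -> level_cdf q i <= level_cdf q j.
Proof.
move=> ij; rewrite /level_cdf [leRHS](bigID (fun s => (lev s <= i)%N))/=.
rewrite [X in _ <= X + _](eq_bigl (fun s => (lev s <= i)%N)).
  by rewrite lerDl sumr_ge0.
move=> s.
by apply/andP/idP => [[]//|h]; split=> //; exact: leq_trans ij.
Qed.

Lemma level_cdfC j : \sum_(s | (j < lev s)%N) q s = 1 - level_cdf q j.
Proof.
rewrite -q1 [in RHS](bigID (fun s => (lev s <= j)%N))/= -/(level_cdf q j) addrAC subrr add0r.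
by apply: eq_bigl => s; rewrite ltnNge.
Qed.

Lemma level_cdf_le1 j : level_cdf q j <= 1.
Proof. by rewrite -subr_ge0 -level_cdfC sumr_ge0. Qed.

Lemma tilt_sum u j : level_cdf q j < 1 -> \sum_s q s * tilt q u j s = 1.
Proof.
move=> p1; rewrite (bigID (fun s => (lev s <= j)%N))/=.
rewrite (eq_bigr (fun s => q s * (1 + u))); last by move=> s; rewrite /tilt => ->.
rewrite [X in _ + X](eq_bigr (fun s => q s *
    (1 - u * level_cdf q j / (1 - level_cdf q j)))); last first.
  by move=> s; rewrite /tilt => /negPf ->.
rewrite -!big_distrl/= -/(level_cdf q j).
under [X in _ + X * _]eq_bigl do rewrite -ltnNge.
by rewrite level_cdfC; field; lra.
Qed.

Lemma expect_likelihood u j : level_cdf q j < 1 -> expect q (likelihood q u j) = 1.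
Proof. by move=> p1; rewrite expect_prod tilt_sum// expr1n. Qed.

(* The martingale property, tested against functions of the levels up to [i]. *)
Lemma expect_likelihood_adapted u i j (G : {ffun 'I_n -> S} -> R) :
  (i <= j)%N -> level_cdf q j < 1 ->
  (forall c c' : {ffun 'I_n -> S}, (forall l, (l <= i)%N -> level_count c l = level_count c' l) ->
    G c = G c') ->
  expect q (fun c => likelihood q u j c * G c) =
  expect q (fun c => likelihood q u i c * G c).
Proof.
move=> ij pj Gad; rewrite -!expect_tilt.
have pi : level_cdf q i < 1 by apply: le_lt_trans pj; exact: level_cdf_homo.
(* [phi] merges all levels beyond [i]. The tilts at [i] and [j] agree up to level [i], and give the
   merged cell equal mass because both totals are one. *)
pose phi s : 'I_i.+2 := inord (minn (lev s) i.+1).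
have phiE s : phi s = minn (lev s) i.+1 :> nat by rewrite inordK// ltnS geq_minr.
apply: (@expect_eq_fibres _ _ _ _ phi) => [b|c c' cc']; last first.
  apply: Gad => l li; apply: eq_card => k; rewrite !inE.
  by have /(congr1 val) := cc' k; rewrite /= !phiE; lia.
have [bi|bi] := leqP b i.
  apply: eq_bigr => s /eqP/(congr1 val); rewrite /= phiE => sb.
  by congr (_ * _); rewrite /tilt !ifT//; lia.
have fib s : (phi s == b) = (i < lev s)%N.
  apply/eqP/idP => [/(congr1 val)|h]; first by rewrite /= phiE; lia.
  by apply/val_inj; rewrite /= phiE; have := ltn_ord b; lia.
rewrite !(eq_bigl _ _ fib).
have rest k : level_cdf q k < 1 -> \sum_(s | (i < lev s)%N) q s * tilt q u k s =
    1 - \sum_(s | (lev s <= i)%N) q s * tilt q u k s.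
  move=> pk; rewrite -(tilt_sum u pk) [in RHS](bigID (fun s => (lev s <= i)%N))/=.
  by rewrite addrAC subrr add0r; apply: eq_bigl => s; rewrite ltnNge.
rewrite !rest//; congr (_ - _); apply: eq_bigr => s si.
by rewrite /tilt si (leq_trans si ij).
Qed.

End probability_weight.

(** Chernoff's bound with exponent one: the exponential moment of the jump is [(1 + (e - 1) M)^n],
    with [M] the mass of the level, and [e <= 4] gives the factor [3]. *)
Lemma big_jump_prob f (j m : nat) : (forall s, 0 <= f s) -> \sum_s f s = 1 ->
  expect f (fun c => (m <= level_jump c j)%N%:R) <=
    expR (3 * n%:R * level_mass f j - m%:R).
Proof.
move=> f0 f1; pose g s : R := if lev s == j then expR 1 else 1.
have gE c : \prod_i g (c i) = expR (level_jump c j)%:R.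
  rewrite /g -big_mkcond/= prodr_const /level_jump.
  by rewrite -expRM_natl mulr1.
apply: (@le_trans _ _ (expect f (fun c => expR (- m%:R) * \prod_i g (c i)))).
  apply: le_expect => // c; rewrite gE -expRD.
  have [h|h] := leqP m (level_jump c j); last exact: expR_ge0.
  by rewrite -[leLHS]expR0 ler_expR addrC subr_ge0 ler_nat.
rewrite expectZ expect_prod addrC expRD ler_pM2l ?expR_gt0//.
have -> : \sum_s f s * g s = 1 + (expR 1 - 1) * level_mass f j.
  have := f1; rewrite (bigID (fun s => lev s == j))/= -/(level_mass f j) => f1'.
  rewrite (bigID (fun s => lev s == j))/=.
  rewrite (eq_bigr (fun s => f s * expR 1)); last by move=> s; rewrite /g => ->.
  rewrite [X in _ + X](eq_bigr f); last by move=> s; rewrite /g => /negPf ->; rewrite mulr1.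
  rewrite -big_distrl/= -/(level_mass f j); lra.
have e4 : expR 1 <= 4 :> R.
  have -> : 1 = 2^-1 + 2^-1 :> R by lra.
  have : expR 2^-1 <= 2 :> R.
    rewrite -[leLHS]invrK -expRN -[leRHS]invrK lef_pV2 ?posrE ?expR_gt0//.
    by have := expR_ge1Dx (- 2^-1 : R); lra.
  have := expR_gt0 (2^-1 : R).
  by rewrite expRD; nra.
have -> : 3 * n%:R * level_mass f j = n%:R * (3 * level_mass f j) by ring.
rewrite expRM_natl.
apply: lerXn2r; rewrite ?nnegrE ?expR_ge0//.
  have := expR_ge1Dx (1 : R); have : 0 <= level_mass f j by exact: sumr_ge0.
  nra.
apply: le_trans (expR_ge1Dx _).
have : 0 <= level_mass f j by exact: sumr_ge0.
nra.
Qed.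

End level_process.

(** * Likelihood ratios stopped at the first exit *)

Section first_exit.
Variables (R : realType) (n : nat) (S : finType) (lev : S -> nat) (q : S -> R).
Hypotheses (n0 : (0 < n)%N) (q0 : forall s, 0 <= q s) (q1 : \sum_s q s = 1).
Implicit Types (j : nat) (c : {ffun 'I_n -> S}) (x t : R).

Let r : R := Num.sqrt n%:R.

Definition deviation c j : R :=
  ((level_count lev c j)%:R - n%:R * level_cdf lev q j) / Num.sqrt n%:R.

(** Only levels strictly below [j] are tested, so [exits x c j] says that the first exit is exactly
    at [j]. *)
Definition stays x c j : bool := all (fun i => `|deviation c i| <= x) (iota 0 j).

Definition exits x c j : bool := stays x c j && (x < `|deviation c j|).

Lemma staysS x c j : stays x c j.+1 = stays x c j && (`|deviation c j| <= x).
Proof. by rewrite /stays -addn1 iotaD all_cat /= andbT. Qed.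

Lemma staysP x c j :
  reflect (forall i, (i < j)%N -> `|deviation c i| <= x) (stays x c j).
Proof.
apply: (iffP allP) => H i; last by rewrite mem_iota => /H.
by move=> ij; apply: H; rewrite mem_iota.
Qed.

Lemma exits_sum x c J : \sum_(j < J) (exits x c j)%:R = 1 - (stays x c J)%:R :> R.
Proof.
elim: J => [|J IH]; first by rewrite big_ord0 subrr.
rewrite big_ord_recr/= IH staysS /exits ltNge.
by case: (stays x c J); case: (_ <= _); rewrite /= ?subr0 ?subrr ?addr0 ?add0r.
Qed.

Lemma deviation_adapted c c' j : level_count lev c j = level_count lev c' j ->
  deviation c j = deviation c' j.
Proof. by rewrite /deviation => ->. Qed.

Lemma exits_adapted x c c' j :
  (forall l, (l <= j)%N -> level_count lev c l = level_count lev c' l) ->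
  exits x c j = exits x c' j.
Proof.
move=> H; rewrite /exits (deviation_adapted (H j (leqnn j))); congr (_ && _).
by apply/staysP/staysP => G i ij; have := G i ij;
  rewrite (deviation_adapted (H i (ltnW ij))).
Qed.

Lemma level_jump_adapted c c' j :
  (forall l, (l <= j)%N -> level_count lev c l = level_count lev c' l) ->
  level_jump lev c j = level_jump lev c' j.
Proof.
case: j => [|j] H; first by rewrite -!level_count0 H.
by have := H j.+1 (leqnn _); rewrite !level_countS H//; lia.
Qed.

Let r0 : 0 < r. Proof. by rewrite sqrtr_gt0 ltr0n. Qed.

Let rr : r * r = n%:R. Proof. by rewrite -expr2 sqr_sqrtr. Qed.

(** Just before the exit the deviation is still within [x]. One level changes it by the centred jump
    over [sqrt n], which lies between [- eta] and [m / sqrt n]. *)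
Lemma exits_overshoot x eta (m : nat) c j : 0 <= x ->
  n%:R * level_mass lev q j <= eta * r -> exits x c j -> (level_jump lev c j < m)%N ->
  `|deviation c j| <= x + (m%:R / r + eta).
Proof.
move=> x0 meta /andP[/staysP st _] jm.
(* The deviation one level earlier; before level [0] nothing is counted and it is [0]. *)
pose a : R := if j is i.+1 then deviation c i else 0.
have aE : deviation c j = a + ((level_jump lev c j)%:R - n%:R * level_mass lev q j) / r.
  rewrite /deviation -/r /a; case: {st jm meta a} j => [|j].
    by rewrite level_count0 level_cdf0 add0r.
  by rewrite level_countS level_cdfS natrD /deviation -/r; lra.
have ax : `|a| <= x by rewrite /a; case: {meta jm aE a} j st => [|j] st;
  [rewrite normr0|exact: st].
have jr : (level_jump lev c j)%:R / r <= m%:R / r.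
  by rewrite ler_pM2r ?invr_gt0// ler_nat ltnW.
have jr0 : 0 <= (level_jump lev c j)%:R / r by rewrite divr_ge0// ltW.
have me : n%:R * level_mass lev q j / r <= eta by rewrite ler_pdivrMr.
have me0 : 0 <= n%:R * level_mass lev q j / r.
  by rewrite divr_ge0// ?(ltW r0)// mulr_ge0// level_mass_ge0.
rewrite aE mulrBl; apply: le_trans (ler_normD _ _) _; apply: lerD => //.
by rewrite ler_norml; apply/andP; split; lra.
Qed.

Section tilted.
Variables (t e : R) (J : nat).
Hypotheses (e0 : 0 < e) (eJ : e <= 1 - level_cdf lev q J) (tr : 2 * (`|t| / e) <= r).

Let eJ' j : (j <= J)%N -> e <= 1 - level_cdf lev q j.
Proof. by move=> jJ; rewrite (le_trans eJ)// lerD2l lerN2 level_cdf_homo. Qed.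

Let pJ j : (j <= J)%N -> level_cdf lev q j < 1.
Proof. by move=> /eJ' ej; rewrite -subr_gt0 (lt_le_trans e0). Qed.

(** The condition [tr] keeps the factors of the tilt nonnegative, so tilted weights are again
    probability weights. *)
Let pos j : (j <= J)%N ->
  [/\ 0 <= 1 + t / r, 1 + t / r <= 2 &
      0 <= 1 - t / r * level_cdf lev q j / (1 - level_cdf lev q j)].
Proof.
move=> jJ; have ej := eJ' jJ; have e0' := e0; have r0' := r0; have p0 := level_cdf_ge0 lev q0 j.
move: (level_cdf lev q j) ej p0 => p ej p0.
have te : `|t| <= `|t| / e by rewrite ler_pdivlMr//; apply: ler_piMr => //; lra.
have te0 : 0 <= `|t| / e by rewrite divr_ge0// ltW.
have trB := tr; have [B BE] : exists B, B = `|t| / e by exists (`|t| / e).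
rewrite -BE in te te0 trB.
have tr1 : `|t / r| <= 2^-1.
  by rewrite normrM normfV (gtr0_norm r0) ler_pdivrMr//; clear BE tr; lra.
have tp : `|t / r * p / (1 - p)| <= 2^-1.
  rewrite !normrM !normfV (gtr0_norm r0) (@gtr0_norm _ (1 - p)); last by lra.
  rewrite (ger0_norm p0).
  have -> : `|t| / r * p / (1 - p) = (`|t| / (1 - p) * p) / r.
    by field; rewrite (gt_eqF r0); lra.
  rewrite ler_pdivrMr//; apply: (@le_trans _ _ (`|t| / (1 - p))).
    by apply: ler_piMr; [rewrite divr_ge0//|]; lra.
  apply: (@le_trans _ _ B); last by clear BE tr; lra.
  by rewrite BE; apply: ler_wpM2l => //; rewrite lef_pV2 ?posrE//; lra.
move: tr1 tp; rewrite !ler_norml => /andP[? ?] /andP[? ?]; split; lra.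
Qed.

Let tilt_ge0 j s : (j <= J)%N -> 0 <= q s * tilt lev q (t / r) j s.
Proof.
by move=> /pos[? _ ?]; rewrite mulr_ge0// /tilt; case: ifP.
Qed.

Lemma likelihood_ge0 j c : (j <= J)%N -> 0 <= likelihood lev q (t / r) j c.
Proof. by move=> /pos[? _ ?]; rewrite likelihoodE mulr_ge0// exprn_ge0. Qed.

(** An exit at [j] depends on levels up to [j] only, so by the martingale property the likelihood at
    [j] may be replaced by that at [J]. The exits and [stays x c J.+1] partition all samples. *)
Lemma optional_stopping x :
  expect q (fun c => likelihood lev q (t / r) J c * (stays x c J.+1)%:R) +
  \sum_(j < J.+1) expect q (fun c => likelihood lev q (t / r) j c * (exits x c j)%:R)
  = 1.
Proof.
rewrite -[RHS](expect_likelihood n q1 (t / r) (pJ (leqnn J))).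
rewrite (eq_bigr (fun j : 'I_J.+1 => expect q (fun c =>
    likelihood lev q (t / r) J c * (exits x c j)%:R))); last first.
  move=> j _; have jJ : (j <= J)%N by rewrite -ltnS.
  rewrite (expect_likelihood_adapted q0 q1 _ jJ (pJ (leqnn J)))//.
  by move=> c c' H; rewrite (exits_adapted _ H).
rewrite -expect_sum -expectD; apply: eq_expect => c.
by rewrite -big_distrr -mulrDr exits_sum/=; ring.
Qed.

(** Retaining only a part [G] of each exit event drops a nonnegative quantity; this lets exits be
    sorted by side and by jump size. *)
Lemma optional_stopping_le1 x (G : nat -> {ffun 'I_n -> S} -> bool) :
  (forall j c, G j c -> exits x c j) ->
  (forall j c c', (forall l, (l <= j)%N -> level_count lev c l = level_count lev c' l) ->
     G j c = G j c') ->
  \sum_(j < J.+1) expect q (fun c => likelihood lev q (t / r) j c * (G j c)%:R) <= 1.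
Proof.
move=> Gex Gad; rewrite -[leRHS](expect_likelihood n q1 (t / r) (pJ (leqnn J))).
rewrite (eq_bigr (fun j : 'I_J.+1 => expect q (fun c =>
    likelihood lev q (t / r) J c * (G j c)%:R))); last first.
  move=> j _; have jJ : (j <= J)%N by rewrite -ltnS.
  rewrite (expect_likelihood_adapted q0 q1 _ jJ (pJ (leqnn J)))//.
  by move=> c c' H; rewrite (Gad _ _ _ H).
rewrite -expect_sum; apply: le_expect => // c.
rewrite -big_distrr/= ler_piMr ?likelihood_ge0//.
apply: (@le_trans _ _ (\sum_(j < J.+1) (exits x c j)%:R)).
  apply: ler_sum => j _; rewrite ler_nat.
  by case: (boolP (G j c)) => // /Gex ->.
by rewrite exits_sum lerBlDr lerDl ler0n.
Qed.

(* Absorbing the likelihood ratio into the weights at most doubles the mass of a level. *)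
Lemma big_jump_likelihood x eta (m : nat) j : (j <= J)%N ->
  n%:R * level_mass lev q j <= eta * r ->
  expect q (fun c => likelihood lev q (t / r) j c *
    (exits x c j && (m <= level_jump lev c j)%N)%:R) <= expR (6 * eta * r - m%:R).
Proof.
move=> jJ meta.
rewrite -(expect_likelihood_adapted q0 q1 _ jJ (pJ (leqnn J))); last first.
  by move=> c c' H; rewrite (exits_adapted _ H) (level_jump_adapted H).
rewrite -expect_tilt.
apply: (@le_trans _ _ (expect (fun s => q s * tilt lev q (t / r) J s)
    (fun c => (m <= level_jump lev c j)%N%:R))).
  apply: le_expect => [s|c]; first exact: tilt_ge0.
  by rewrite ler_nat; case: exits.
have q0' s : 0 <= q s * tilt lev q (t / r) J s by exact: tilt_ge0.
have q1' := tilt_sum q1 (t / r) (pJ (leqnn J)).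
apply: le_trans (big_jump_prob n lev j m q0' q1') _.
rewrite ler_expR lerB//.
have -> : level_mass lev (fun s => q s * tilt lev q (t / r) J s) j =
    level_mass lev q j * (1 + t / r).
  rewrite /level_mass big_distrl/=; apply: eq_bigr => s /eqP sj.
  by rewrite /tilt sj jJ.
have [H1 H2 _] := pos (leqnn J); move: H1 H2.
have := level_mass_ge0 lev q0 j; have : 0 <= n%:R :> R by [].
move: meta; set N := n%:R; set M := level_mass lev q j; set u := t / r => meta N0 M0 u1 u2.
have NM : 0 <= N * M by exact: mulr_ge0.
have : N * M * (1 + u) <= N * M * 2 by apply: ler_wpM2l; lra.
lra.
Qed.

Lemma likelihood_approx Z j c : (j <= J)%N -> `|deviation c j| <= Z ->
  exists2 d : R, `|d| <= (4 * (`|t| / e) ^+ 3 + Z * (`|t| / e) ^+ 2) / r &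
    likelihood lev q (t / r) j c =
    expR (t * deviation c j / (1 - level_cdf lev q j)
      - t ^+ 2 * level_cdf lev q j / (2 * (1 - level_cdf lev q j)) + d).
Proof.
move=> jJ zZ; rewrite likelihoodE.
apply: (likelihood_ratio_approx n0 (level_count_le _ _ _) (level_cdf_ge0 lev q0 _)
  (erefl _) e0 (eJ' jJ) (erefl _) zZ tr).
Qed.

End tilted.

(** Union bound. The rate [6] instead of [3] is the one needed for tilted weights, so that a single
    exponent serves both. *)
Lemma big_jump_prob_sum eta (m : nat) J :
  (forall j, n%:R * level_mass lev q j <= eta * r) -> 0 <= eta ->
  \sum_(j < J) expect q (fun c => (m <= level_jump lev c j)%N%:R) <=
    J%:R * expR (6 * eta * r - m%:R).
Proof.
move=> meta eta0; rewrite -[J in J%:R]card_ord -sum1_card natr_sum big_distrl/=.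
apply: ler_sum => j _; rewrite mul1r.
apply: le_trans (big_jump_prob n lev j m q0 q1) _; rewrite ler_expR lerB//.
have := meta j; have : 0 <= eta * r by rewrite mulr_ge0// ltW.
lra.
Qed.

(* Doob's maximal inequality for the exponential martingales of parameters
   [t] and [-t]. *)
Lemma early_exit_prob x t a eta (m J : nat) : 0 < x -> 0 <= t -> 4 * t <= r ->
  level_cdf lev q J <= a -> a <= 2^-1 ->
  (forall j, n%:R * level_mass lev q j <= eta * r) -> 0 <= eta ->
  m%:R / r + eta <= 1 ->
  expect q (fun c => (~~ stays x c J.+1)%:R) <=
    2 * expR (- (x * t - t ^+ 2 * a - (4 * (2 * t) ^+ 3 + (x + 1) * (2 * t) ^+ 2) / r))
    + J.+1%:R * expR (6 * eta * r - m%:R).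
Proof.
move=> x0 t0 tr pa a2 meta eta0 m1.
set D := _ / r; set A := expR (- _).
(* At least half of the mass remains beyond [J], so [e = 1/2] and [|t| / e] becomes [2 t]. *)
have e0 : 0 < 2^-1 :> R by lra.
have eJ : 2^-1 <= 1 - level_cdf lev q J by lra.
(* [b] selects the side of the exit. There the likelihood of parameter [(-1)^b t] is at least the
   inverse of [A]; exits with a jump of at least [m] are counted apart. *)
pose up (b : bool) j c := [&& exits x c j, (0 < (-1) ^+ b * deviation c j) &
  (level_jump lev c j < m)%N].
have side b : \sum_(j < J.+1) expect q (fun c => (up b j c)%:R) <= A.
  have trb : 2 * (`|(-1) ^+ b * t| / 2^-1) <= r.
    by rewrite normrM normrX normrN1 expr1n mul1r invrK ger0_norm//; lra.
  have := @optional_stopping_le1 _ _ _ e0 eJ trb x (up b) => os1.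
  rewrite /A expRN -[leRHS]mulr1 ler_pdivlMl ?expR_gt0//.
  have ad j c c' : (forall l, (l <= j)%N -> level_count lev c l = level_count lev c' l) ->
      up b j c = up b j c'.
    by move=> H; rewrite /up (exits_adapted _ H) (level_jump_adapted H) (deviation_adapted (H _ (leqnn _))).
  have upex j c : up b j c -> exits x c j by move=> /and3P[].
  apply: le_trans (os1 upex ad).
  rewrite big_distrr/=; apply: ler_sum => j _; rewrite -expectZ.
  apply: le_expect => // c; case: (boolP (up b j c)) => [|_]; last by rewrite !mulr0.
  move=> /and3P[ex dpos jm]; rewrite !mulr1.
  have jJ : (j <= J)%N by rewrite -ltnS.
  have os := exits_overshoot (ltW x0) (meta j) ex jm.
  have zZ : `|deviation c j| <= x + 1 by lra.
  have [d dD ->] := likelihood_approx e0 eJ trb jJ zZ.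
  move: dD; rewrite normrM normrX normrN1 expr1n mul1r invrK (ger0_norm t0) (mulrC t) -/D.
  move=> dD; rewrite ler_expR.
  have /andP[_ xz] := ex.
  have zE : (-1) ^+ b * deviation c j = `|deviation c j|.
    by rewrite -(gtr0_norm dpos) normrM normrX normrN1 expr1n mul1r.
  have pj : level_cdf lev q j <= a.
    by apply: le_trans pa; exact: level_cdf_homo.
  have pj0 := level_cdf_ge0 lev q0 j.
  set p := level_cdf lev q j in pj pj0 *.
  have p1 : 2^-1 <= 1 - p by lra.
  rewrite [((-1) ^+ b * t) ^+ 2]exprMn sqrr_sign mul1r.
  have -> : (-1) ^+ b * t * deviation c j = t * `|deviation c j|.
    by rewrite -zE; ring.
  have H1 : x * t <= t * `|deviation c j| / (1 - p).
    rewrite ler_pdivlMr; last by lra.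
    apply: (@le_trans _ _ (x * t)); first by rewrite ler_piMr// ?mulr_ge0//; lra.
    by rewrite mulrC ler_wpM2l// ltW.
  have H2 : t ^+ 2 * p / (2 * (1 - p)) <= t ^+ 2 * a.
    rewrite ler_pdivrMr; last by lra.
    have ta : t ^+ 2 * p <= t ^+ 2 * a by rewrite ler_wpM2l// sqr_ge0.
    by apply: le_trans ta _; apply: ler_peMr; rewrite ?mulr_ge0 ?sqr_ge0//; lra.
  by move: dD; rewrite ler_norml => /andP[? ?]; lra.
have bad := big_jump_prob_sum m J.+1 meta eta0.
have all3 := lerD (lerD (side false) (side true)) bad.
have -> : 2 * A = A + A by ring.
apply: le_trans all3.
rewrite -!big_split/=.
have -> : \sum_(j < J.+1) (expect q (fun c => (up false j c)%:R) +
   expect q (fun c => (up true j c)%:R) +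
   expect q (fun c => (m <= level_jump lev c j)%N%:R)) =
   expect q (fun c => \sum_(j < J.+1) ((up false j c)%:R + (up true j c)%:R +
     (m <= level_jump lev c j)%N%:R)).
  by rewrite expect_sum; apply: eq_bigr => j _; rewrite !expectD.
apply: le_expect => // c.
have -> : (~~ stays x c J.+1)%:R = 1 - (stays x c J.+1)%:R :> R.
  by case: stays; rewrite ?subrr ?subr0.
rewrite -exits_sum; apply: ler_sum => j _; rewrite -!natrD ler_nat /up.
(* Every exit is upward, downward, or comes with a big jump. *)
case: (boolP (exits x c j)) => // /andP[_ xd].
have d0 : 0 < `|deviation c j| by exact: lt_trans xd.
rewrite expr0 expr1 mul1r mulN1r oppr_gt0 ltnNge.
move: d0; rewrite normr_gt0 neq_lt => /orP[] ->; case: (m <= _)%N;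
  by rewrite ?andbT ?andbF ?addn0 ?addn1//; case: (_ < _).
Qed.

End first_exit.

(** * The method of images *)

Section images.
Variable R : realType.
Implicit Types (x s z : R) (K k : nat).

Definition kolmogorov_partial K x : R :=
  1 + 2 * \sum_(k < K) (-1) ^+ k.+1 * expR (- (2 * k.+1%:R ^+ 2 * x ^+ 2)).

(** Repeated reflection of the origin in the barriers [x] and [- x] puts images at distances
    [2 (k + 1) x], counted from [k = 0]. At this rate [t], [exp(- t^2 / 2)] is a term of
    Kolmogorov's series up to sign. *)
Definition image_rate x k : R := 2 * k.+1%:R * x.

(* Method of images: up to the truncation at [K], the probability that a Brownian bridge
   at [z], with time [s] to go before returning to [0], stays in [[-x, x]]. *)
Definition images K x s z : R :=
  1 + \sum_(k < K) (-1) ^+ k.+1 *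
    (expR (image_rate x k * z / s - image_rate x k ^+ 2 / (2 * s)) +
     expR (- image_rate x k * z / s - image_rate x k ^+ 2 / (2 * s))).

Lemma image_rate_ge0 x k : 0 <= x -> 0 <= image_rate x k.
Proof. by move=> x0; rewrite /image_rate !mulr_ge0. Qed.

Lemma image_rate_le x K k : 0 <= x -> (k < K)%N -> image_rate x k <= 2 * K%:R * x.
Proof. by move=> x0 kK; rewrite ler_wpM2r// ler_wpM2l// ler_nat. Qed.

Lemma image_rate_ge x k : 0 <= x -> 2 * x <= image_rate x k.
Proof. by move=> x0; rewrite ler_wpM2r// ler_peMr// ler1n. Qed.

Lemma alternating_sum_le K (f g : nat -> R) M :
  (forall k, (k < K)%N -> `|f k| <= M) -> (forall k, (k < K)%N -> `|g k| <= M) ->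
  `|\sum_(k < K) (-1) ^+ k.+1 * (f k + g k)| <= 2 * K%:R * M.
Proof.
move=> fM gM; apply: le_trans (ler_norm_sum _ _ _) _.
have -> : 2 * K%:R * M = \sum_(k < K) (2 * M).
  by rewrite sumr_const card_ord -[RHS]mulr_natl; ring.
apply: ler_sum => k _; rewrite normrM normrX normrN1 expr1n mul1r.
have := fM k (ltn_ord k); have := gM k (ltn_ord k).
by have := ler_normD (f k) (g k); lra.
Qed.

(* At the boundary the images cancel pairwise. *)
Lemma images_boundary K x s : 0 < s ->
  images K x s x = (-1) ^+ K * expR (- (2 * K%:R * K.+1%:R * x ^+ 2 / s)).
Proof.
move=> s0; rewrite /images; elim: K => [|K IH].
  by rewrite big_ord0 !(mulr0, mul0r, oppr0, addr0) expr0 expR0 mulr1.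
rewrite big_ord_recr/= addrA IH mulrDr addrA.
(* At [z = x] one of the two new images cancels what the first [K] pairs leave; the other is the new
   remainder. *)
have -> : image_rate x K * x / s - image_rate x K ^+ 2 / (2 * s) =
    - (2 * K%:R * K.+1%:R * x ^+ 2 / s).
  by rewrite /image_rate -natr1; field; rewrite gt_eqF.
have -> : - image_rate x K * x / s - image_rate x K ^+ 2 / (2 * s) =
    - (2 * K.+1%:R * K.+2%:R * x ^+ 2 / s).
  by rewrite /image_rate -!natr1; field; rewrite gt_eqF.
by rewrite !exprS; ring.
Qed.

Lemma imagesN K x s z : images K x s (- z) = images K x s z.
Proof.
rewrite /images; congr (_ + _); apply: eq_bigr => k _; congr (_ * _).
by rewrite addrC !mulrNN !mulrN !mulNr.
Qed.

(** Each exponent has slope at most [B] in absolute value and stays below [Z * B]. The estimate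
    carries the boundary value to points slightly beyond the boundary. *)
Lemma images_lipschitz K x s e Z y z : 0 <= x -> 0 < e -> e <= s ->
  `|y| <= Z -> `|z| <= Z ->
  `|images K x s y - images K x s z| <=
    2 * K%:R * (`|y - z| * (2 * K%:R * x / e) * expR (Z * (2 * K%:R * x / e))).
Proof.
move=> x0 e0 es yZ zZ; have s0 := lt_le_trans e0 es.
have Z0 : 0 <= Z := le_trans (normr_ge0 _) yZ.
set B := 2 * K%:R * x / e.
have B0 : 0 <= B by rewrite !mulr_ge0// invr_ge0 ltW.
have tB k : (k < K)%N -> image_rate x k / s <= B.
  move=> kK; apply: ler_pM; rewrite ?image_rate_ge0 ?invr_ge0 ?image_rate_le//.
    exact: ltW.
  by rewrite lef_pV2.
have t0 k : 0 <= image_rate x k / s by rewrite divr_ge0 ?image_rate_ge0// ltW.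
rewrite /images opprD addrACA subrr add0r -sumrB.
under eq_bigr do rewrite -mulrBr opprD addrACA.
have E k (w : R) : (k < K)%N -> `|w| <= Z ->
    image_rate x k * w / s - image_rate x k ^+ 2 / (2 * s) <= Z * B.
  move=> kK wZ; apply: (@le_trans _ _ (image_rate x k * w / s)).
    by rewrite gerBl divr_ge0 ?sqr_ge0// mulr_ge0// ltW.
  rewrite mulrAC mulrC; apply: le_trans (ler_norm _) _; rewrite normrM.
  by apply: ler_pM => //; rewrite ger0_norm// tB.
pose f k (w : R) := expR (image_rate x k * w / s - image_rate x k ^+ 2 / (2 * s)).
have fL k (v w : R) : (k < K)%N -> `|v| <= Z -> `|w| <= Z ->
    `|f k v - f k w| <= `|v - w| * B * expR (Z * B).
  move=> kK vZ wZ; apply: le_trans (ler_dist_expR (E k v kK vZ) (E k w kK wZ)) _.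
  rewrite ler_wpM2r ?expR_ge0//.
  have -> : image_rate x k * v / s - image_rate x k ^+ 2 / (2 * s) -
    (image_rate x k * w / s - image_rate x k ^+ 2 / (2 * s)) =
    (v - w) * (image_rate x k / s) by ring.
  by rewrite normrM ler_wpM2l// ger0_norm// tB.
apply: (alternating_sum_le (f := fun k => f k y - f k z)
    (g := fun k => expR (- image_rate x k * y / s - image_rate x k ^+ 2 / (2 * s)) -
      expR (- image_rate x k * z / s - image_rate x k ^+ 2 / (2 * s)))) => k kK.
  exact: fL.
have yz : - y - - z = - (y - z) by ring.
have := @fL k (- y) (- z) kK; rewrite /f yz !normrN !mulrN !mulNr.
exact.
Qed.

Lemma images_near1 K x s z M : 0 < s -> 0 <= x ->
  (forall k, (k < K)%N -> image_rate x k * `|z| / s - image_rate x k ^+ 2 / (2 * s) <= M) ->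
  `|images K x s z - 1| <= 2 * K%:R * expR M.
Proof.
move=> s0 x0 H; rewrite /images addrAC subrr add0r.
have E k (w : R) : (k < K)%N -> w <= `|z| ->
    `|expR (image_rate x k * w / s - image_rate x k ^+ 2 / (2 * s))| <= expR M.
  move=> kK wz; rewrite ger0_norm ?expR_ge0// ler_expR; apply: le_trans (H k kK).
  by rewrite lerB// ler_wpM2r ?invr_ge0 ?(ltW s0)// ler_wpM2l// image_rate_ge0.
apply: (@alternating_sum_le K
  (fun k => expR (image_rate x k * z / s - image_rate x k ^+ 2 / (2 * s)))
  (fun k => expR (- image_rate x k * z / s - image_rate x k ^+ 2 / (2 * s)))) => k kK.
  by apply: E => //; exact: ler_norm.
by rewrite mulNr -mulrN; apply: E => //; rewrite -normrN ler_norm.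
Qed.

(** The exponent at rate [t] is [- t (t / 2 - |z|) / s], at most [- x^2 / s] because [t >= 2 x].
    With little time [s] to go, all images are negligible. *)
Lemma images_center K x s a z : 0 < s -> s <= a -> 0 < x -> `|z| <= x / 2 ->
  `|images K x s z - 1| <= 2 * K%:R * expR (- (x ^+ 2 / a)).
Proof.
move=> s0 sa x0 zx; apply: images_near1 => //; first exact: ltW.
move=> k kK; have t2 := image_rate_ge k (ltW x0); set t := image_rate x k in t2 *.
have -> : t * `|z| / s - t ^+ 2 / (2 * s) = - (t * (t / 2 - `|z|) / s).
  by field; rewrite gt_eqF.
rewrite lerN2; apply: (@le_trans _ _ (x ^+ 2 / s)).
  by rewrite ler_wpM2l ?sqr_ge0// lef_pV2 ?posrE//; exact: lt_le_trans sa.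
rewrite ler_wpM2r ?invr_ge0 ?(ltW s0)// expr2.
have : x * x <= t * (x / 2) by nra.
have : t * (x / 2) <= t * (t / 2 - `|z|) by apply: ler_wpM2l; lra.
lra.
Qed.

(** Within the strip all exponents are nonpositive. This crude bound serves on the unlikely event
    that the path is outside the inner half of the strip shortly before the end. *)
Lemma images_inside K x s z : 0 < s -> 0 < x -> `|z| <= x ->
  `|images K x s z - 1| <= 2 * K%:R.
Proof.
move=> s0 x0 zx; rewrite -[leRHS]mulr1 -[X in _ <= _ * X]expR0; apply: images_near1 => //; first exact: ltW.
move=> k kK; have t2 := image_rate_ge k (ltW x0); set t := image_rate x k in t2 *.
have -> : t * `|z| / s - t ^+ 2 / (2 * s) = - (t * (t / 2 - `|z|) / s).
  by field; rewrite gt_eqF.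
rewrite oppr_le0 divr_ge0 ?(ltW s0)// mulr_ge0//; lra.
Qed.

(** By symmetry only the upper boundary matters. There a single image survives, bounded through
    [s <= 1]; the overshoot [w] is paid by the Lipschitz estimate. *)
Lemma images_overshoot K x s e z w : 0 < x -> 0 < e -> e <= s -> s <= 1 -> w <= 1 ->
  x < `|z| -> `|z| <= x + w ->
  `|images K x s z| <= expR (- (2 * K%:R * K.+1%:R * x ^+ 2)) +
    2 * K%:R * (w * (2 * K%:R * x / e) * expR ((x + 1) * (2 * K%:R * x / e))).
Proof.
move=> x0 e0 es s1 w1 xz zw; have s0 := lt_le_trans e0 es.
have -> : images K x s z = images K x s `|z|.
  by have [z0|z0] := leP 0 z; rewrite ?(ger0_norm z0)// ltr0_norm// imagesN.
have zZ : `| `|z| | <= x + 1 by rewrite normr_id; lra.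
have xZ : `|x| <= x + 1 by rewrite gtr0_norm//; lra.
have := images_lipschitz K (ltW x0) e0 es zZ xZ.
rewrite images_boundary// => L.
have B : `|(-1) ^+ K * expR (- (2 * K%:R * K.+1%:R * x ^+ 2 / s))| <=
    expR (- (2 * K%:R * K.+1%:R * x ^+ 2)).
  rewrite normrM normrX normrN1 expr1n mul1r ger0_norm ?expR_ge0// ler_expR lerN2.
  by rewrite ler_peMr ?invf_ge1// !mulr_ge0// ?sqr_ge0// ltW.
apply: le_trans (_ : _ <= `|images K x s `|z| - (-1) ^+ K *
    expR (- (2 * K%:R * K.+1%:R * x ^+ 2 / s))| +
  `|(-1) ^+ K * expR (- (2 * K%:R * K.+1%:R * x ^+ 2 / s))|) _.
  by rewrite -[X in `|X| <= _](subrK ((-1) ^+ K * expR (- (2 * K%:R * K.+1%:R * x ^+ 2 / s)))) ler_normD.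
rewrite addrC lerD// (le_trans L)// ler_wpM2l// ?mulr_ge0//.
rewrite ler_wpM2r ?expR_ge0// ler_wpM2r//.
  by rewrite !mulr_ge0// ?invr_ge0 ltW.
by rewrite ger0_norm; lra.
Qed.

End images.

(** * Optional stopping for the combination of images *)

Section first_exit_asymptotics.
Variables (R : realType) (n : nat) (S : finType) (lev : S -> nat) (q : S -> R).
Hypotheses (n0 : (0 < n)%N) (q0 : forall s, 0 <= q s) (q1 : \sum_s q s = 1).
Implicit Types (j : nat) (c : {ffun 'I_n -> S}) (x : R).

Let r : R := Num.sqrt n%:R.

Let r0 : 0 < r. Proof. by rewrite sqrtr_gt0 ltr0n. Qed.

(** The likelihood ratios take the place of the exponential martingales in [images]. The factor
    [exp(- t^2 / 2)] completes [- t^2 p / (2 s)] to [- t^2 / (2 s)], as [1 + p / s = 1 / s]. *)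
Definition image_martingale x K j c : R :=
  1 + \sum_(k < K) (-1) ^+ k.+1 *
    (expR (- (image_rate x k ^+ 2 / 2)) * likelihood lev q (image_rate x k / r) j c +
     expR (- (image_rate x k ^+ 2 / 2)) * likelihood lev q (- image_rate x k / r) j c).

Section parameters.
Variables (x e eta : R) (m J K : nat).
(** [B] bounds [image_rate / s] up to level [J], [D] the error in the logarithm of a likelihood
    ratio, [w] the overshoot at an exit without a big jump. *)
Let B : R := 2 * K%:R * x / e.
Let D : R := (4 * B ^+ 3 + (x + 1) * B ^+ 2) / r.
Let w : R := m%:R / r + eta.
Hypotheses (x0 : 0 < x) (e0 : 0 < e) (eJ : e <= 1 - level_cdf lev q J)
  (Br : 2 * B <= r) (D1 : D <= 1)
  (meta : forall j, n%:R * level_mass lev q j <= eta * r) (eta0 : 0 <= eta) (w1 : w <= 1).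

Let eJ' j : (j <= J)%N -> e <= 1 - level_cdf lev q j.
Proof. by move=> jJ; rewrite (le_trans eJ)// lerD2l lerN2 level_cdf_homo. Qed.

Let B0 : 0 <= B.
Proof. by rewrite /B !mulr_ge0// ?invr_ge0 ltW. Qed.

Let signF (y : R) : (-1) ^+ false * y = y.
Proof. exact: mul1r. Qed.

Let signT (y : R) : (-1) ^+ true * y = - y.
Proof. exact: mulN1r. Qed.

Let rateB (b : bool) k : (k < K)%N -> `|(-1) ^+ b * image_rate x k| / e <= B.
Proof.
move=> kK; rewrite normrM normrX normrN1 expr1n mul1r ger0_norm ?image_rate_ge0 ?(ltW x0)//.
by rewrite ler_wpM2r ?invr_ge0 ?(ltW e0)// image_rate_le// ltW.
Qed.

Let rater (b : bool) k : (k < K)%N -> 2 * (`|(-1) ^+ b * image_rate x k| / e) <= r.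
Proof. by move=> kK; apply: le_trans Br; rewrite ler_wpM2l// rateB. Qed.

(** The two exponents differ by at most [D], and [D <= 1] keeps both below [(x + 1) B + 1]. *)
Let term_approx (b : bool) k j c : (k < K)%N -> (j <= J)%N ->
  `|deviation lev q c j| <= x + 1 ->
  `|expR (- (image_rate x k ^+ 2 / 2)) *
      likelihood lev q ((-1) ^+ b * image_rate x k / r) j c -
    expR ((-1) ^+ b * image_rate x k * deviation lev q c j / (1 - level_cdf lev q j)
      - image_rate x k ^+ 2 / (2 * (1 - level_cdf lev q j)))| <=
  D * expR ((x + 1) * B + 1).
Proof.
move=> kK jJ zx.
have [d dD ->] := likelihood_approx n0 q0 e0 eJ (rater b kK) jJ zx.
have {}dD : `|d| <= D.
  apply: le_trans dD _; rewrite /D ler_wpM2r ?invr_ge0 ?(ltW r0)//.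
  have bB := rateB b kK.
  have b0 : 0 <= `|(-1) ^+ b * image_rate x k| / e by rewrite divr_ge0// ltW.
  have x1 : 0 <= x + 1 by have := x0; lra.
  by apply: lerD; apply: ler_wpM2l => //; rewrite lerXn2r ?nnegrE.
have ej := eJ' jJ; set p := level_cdf lev q j in ej *.
set t := image_rate x k; set z := deviation lev q c j in zx *.
have p1 : 0 < 1 - p by exact: lt_le_trans e0 ej.
rewrite -expRD.
have -> : - (t ^+ 2 / 2) + ((-1) ^+ b * t * z / (1 - p) -
   ((-1) ^+ b * t) ^+ 2 * p / (2 * (1 - p)) + d) =
   (-1) ^+ b * t * z / (1 - p) - t ^+ 2 / (2 * (1 - p)) + d.
  rewrite [((-1) ^+ b * t) ^+ 2]exprMn sqrr_sign mul1r.
  by field; rewrite gt_eqF.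
have tz : (-1) ^+ b * t * z / (1 - p) - t ^+ 2 / (2 * (1 - p)) <= (x + 1) * B.
  apply: (@le_trans _ _ ((-1) ^+ b * t * z / (1 - p))).
    by rewrite gerBl divr_ge0 ?sqr_ge0// mulr_ge0// ltW.
  rewrite mulrAC mulrC; apply: le_trans (ler_norm _) _; rewrite normrM.
  apply: ler_pM => //; rewrite normrM normfV (gtr0_norm p1).
  apply: le_trans (rateB b kK); rewrite ler_wpM2l// lef_pV2 ?posrE//.
have d1 : d <= 1 by apply: le_trans (le_trans (ler_norm d) dD) D1.
set y := _ - _ in tz *.
apply: le_trans (@ler_dist_expR _ _ _ ((x + 1) * B + 1) _ _) _; [lra|lra|].
by rewrite addrAC subrr add0r ler_wpM2r// expR_ge0.
Qed.

Let approx j c : (j <= J)%N -> `|deviation lev q c j| <= x + 1 ->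
  `|image_martingale x K j c - images K x (1 - level_cdf lev q j) (deviation lev q c j)| <=
  2 * K%:R * (D * expR ((x + 1) * B + 1)).
Proof.
move=> jJ zx; rewrite /image_martingale /images opprD addrACA subrr add0r -sumrB.
under eq_bigr do rewrite -mulrBr opprD addrACA.
pose h (b : bool) k := expR (- (image_rate x k ^+ 2 / 2)) *
      likelihood lev q ((-1) ^+ b * image_rate x k / r) j c -
    expR ((-1) ^+ b * image_rate x k * deviation lev q c j / (1 - level_cdf lev q j)
      - image_rate x k ^+ 2 / (2 * (1 - level_cdf lev q j))).
have hB b k : (k < K)%N -> `|h b k| <= D * expR ((x + 1) * B + 1).
  by move=> kK; exact: term_approx.
rewrite (_ : \sum_(_ < K) _ = \sum_(k < K) (-1) ^+ k.+1 * (h false k + h true k)).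
  exact: alternating_sum_le (hB false) (hB true).
by apply: eq_bigr => k _; rewrite /h !signF !signT.
Qed.

(** By linearity, optional stopping gives [1] for each likelihood ratio; the remaining coefficients
    are the terms of the series. *)
Let expect_image_martingale : 
  expect q (fun c => image_martingale x K J c * (stays lev q x c J.+1)%:R) +
  \sum_(j < J.+1) expect q (fun c => image_martingale x K j c * (exits lev q x c j)%:R)
  = kolmogorov_partial K x.
Proof.
have lin j (G : {ffun 'I_n -> S} -> R) : expect q (fun c => image_martingale x K j c * G c) =
   expect q G + \sum_(k < K) (-1) ^+ k.+1 * expR (- (image_rate x k ^+ 2 / 2)) *
     (expect q (fun c => likelihood lev q (image_rate x k / r) j c * G c) +
      expect q (fun c => likelihood lev q (- image_rate x k / r) j c * G c)).
  under [X in _ = _ + X]eq_bigr do rewrite -expectD -expectZ.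
  rewrite -expect_sum -expectD; apply: eq_expect => c.
  rewrite /image_martingale mulrDl mul1r big_distrl/=; congr (_ + _).
  by apply: eq_bigr => k _; ring.
rewrite lin; under [X in _ + X = _]eq_bigr do rewrite lin.
rewrite big_split/= addrACA; congr (_ + _).
  rewrite -[RHS](expect_cst n 1 q1) -expect_sum -expectD.
  by apply: eq_expect => c; rewrite exits_sum; ring.
rewrite [X in _ + X = _]exchange_big/= -big_split/= [RHS]big_distrr/=.
apply: eq_bigr => k _; rewrite -big_distrr/= -mulrDr big_split/= addrACA.
have os (b : bool) := optional_stopping n q0 q1 ((-1) ^+ b * image_rate x k) e0 eJ x.
have := os false; have := os true; rewrite signF signT => -> ->.
rewrite /image_rate (_ : - _ = - (2 * k.+1%:R ^+ 2 * x ^+ 2)); first by ring.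
by field.
Qed.

(** Size of the image martingale at an exit without a big jump; the summands are the surviving
    boundary image, the overshoot, and the error of the exponential approximation. *)
Let overshoot_bound : R :=
  expR (- (2 * K%:R * K.+1%:R * x ^+ 2)) +
  2 * K%:R * (w * B * expR ((x + 1) * B)) +
  2 * K%:R * (D * expR ((x + 1) * B + 1)).

Let D0 : 0 <= D.
Proof.
rewrite divr_ge0 ?(ltW r0)// addr_ge0// mulr_ge0 ?exprn_ge0//.
by have := x0; lra.
Qed.

Let overshoot_ge0 : 0 <= overshoot_bound.
Proof.
have w0 : 0 <= w by apply: addr_ge0 eta0; exact: divr_ge0 (ler0n _ _) (ltW r0).
have K2 : 0 <= 2 * K%:R :> R by rewrite mulr_ge0.
have E (y : R) := expR_ge0 y.
have DE := mulr_ge0 D0 (E ((x + 1) * B + 1)).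
have wE := mulr_ge0 (mulr_ge0 w0 B0) (E ((x + 1) * B)).
by rewrite /overshoot_bound; apply: addr_ge0 (mulr_ge0 K2 DE); apply: addr_ge0 (mulr_ge0 K2 wE).
Qed.

(** A big jump leaves the overshoot uncontrolled; there the martingale is bounded by [1] plus its
    [2 K] likelihood ratios, each absorbed into its own tilted law. *)
Let exit_term j : (j <= J)%N ->
  expect q (fun c => `|image_martingale x K j c * (exits lev q x c j)%:R|) <=
  overshoot_bound * expect q (fun c => (exits lev q x c j)%:R) +
  (1 + 2 * K%:R) * expR (6 * eta * r - m%:R).
Proof.
move=> jJ; pose big c := (exits lev q x c j && (m <= level_jump lev c j)%N).
pose L (b : bool) k c := likelihood lev q ((-1) ^+ b * image_rate x k / r) j c.
have L0 b k c : (k < K)%N -> 0 <= L b k c.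
  by move=> kK; exact: (likelihood_ge0 n0 q0 e0 eJ (rater b kK) c jJ).
apply: (@le_trans _ _ (expect q (fun c => overshoot_bound * (exits lev q x c j)%:R +
   ((big c)%:R + \sum_(k < K) (L false k c * (big c)%:R + L true k c * (big c)%:R))))).
  apply: le_expect => // c; rewrite /big.
  case: (boolP (exits lev q x c j)) => [ex|_]; last first.
    rewrite !mulr0 normr0 !add0r; apply: sumr_ge0 => k _.
    by rewrite !mulr0 addr0.
  have [jm|jm] := leqP m (level_jump lev c j).
    rewrite /= !mulr1; under [X in _ <= _ + (_ + X)]eq_bigr do rewrite !mulr1.
    apply: le_trans (_ : 1 + \sum_(k < K) (L false k c + L true k c) <= _); last first.
      by rewrite lerDr overshoot_ge0.
    rewrite /image_martingale; apply: le_trans (ler_normD _ _) _; rewrite normr1 lerD2l.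
    apply: le_trans (ler_norm_sum _ _ _) _; apply: ler_sum => k _.
    rewrite normrM normrX normrN1 expr1n mul1r -mulrDr normrM.
    have := L0 false k c (ltn_ord k); have := L0 true k c (ltn_ord k).
    rewrite /L signF signT => l1 l2.
    rewrite ger0_norm ?expR_ge0// ger0_norm ?addr_ge0//.
    rewrite ler_piMl ?addr_ge0// expR_le1 oppr_le0 divr_ge0// sqr_ge0//.
  rewrite /= mulr0n !mulr1 big1; last by move=> k _; rewrite !mulr0 addr0.
  rewrite !addr0.
  have os := exits_overshoot n0 q0 (ltW x0) (meta j) ex jm.
  have /andP[_ xz] := ex.
  have zx : `|deviation lev q c j| <= x + 1.
    by apply: le_trans os _; rewrite lerD2l.
  have A := approx jJ zx.
  have s1 : 1 - level_cdf lev q j <= 1.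
    by rewrite gerBl level_cdf_ge0.
  have I := images_overshoot K x0 e0 (eJ' jJ) s1 w1 xz os.
  rewrite /overshoot_bound; set W := image_martingale _ _ _ _ in A *.
  set g := images _ _ _ _ in A I.
  have : `|W| <= `|W - g| + `|g| by rewrite -{1}(subrK g W) ler_normD.
  by move: A I; rewrite -/B; lra.
rewrite expectD expectZ lerD2l expectD mulrDl mul1r expect_sum; apply: lerD.
  apply: le_trans (_ : expect q (fun c => (m <= level_jump lev c j)%N%:R) <= _).
    by apply: le_expect => // c; rewrite ler_nat /big; case: exits.
  apply: le_trans (big_jump_prob n lev j m q0 q1) _; rewrite ler_expR lerB//.
  have := meta j; have : 0 <= eta * r by rewrite mulr_ge0// ltW.
  lra.
have -> : 2 * K%:R * expR (6 * eta * r - m%:R) = \sum_(k < K) (2 * expR (6 * eta * r - m%:R)).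
  by rewrite sumr_const card_ord -[RHS]mulr_natl; ring.
apply: ler_sum => k _; rewrite expectD.
have bj (b : bool) := big_jump_likelihood n0 q0 q1 e0 eJ (rater b (ltn_ord k)) x m jJ (meta j).
by have := bj false; have := bj true; rewrite /L /big; lra.
Qed.

(** With [W] the image martingale, the difference is the expectation of [1 - W] over the paths that
    stay, minus that of [W] at exits. At level [J], [W] is near [1] unless the deviation exceeds
    [x / 2]. *)
Lemma first_exit_prob a : 1 - level_cdf lev q J <= a ->
  `|expect q (fun c => (stays lev q x c J.+1)%:R) - kolmogorov_partial K x| <=
  overshoot_bound + (1 + 2 * K%:R) * (J.+1%:R * expR (6 * eta * r - m%:R)) +
  (2 * K%:R * expR (- (x ^+ 2 / a)) + 2 * K%:R * (D * expR ((x + 1) * B + 1)) +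
   2 * K%:R * expect q (fun c => (x / 2 < `|deviation lev q c J|)%R%:R)).
Proof.
move=> sa; have s0 : 0 < 1 - level_cdf lev q J by exact: lt_le_trans e0 eJ.
rewrite -expect_image_martingale opprD addrA -expectB.
apply: le_trans (ler_normB _ _) _; rewrite addrC; apply: lerD.
  apply: le_trans (ler_norm_sum _ _ _) _.
  apply: (@le_trans _ _ (\sum_(j < J.+1) (overshoot_bound *
      expect q (fun c => (exits lev q x c j)%:R) +
      (1 + 2 * K%:R) * expR (6 * eta * r - m%:R)))).
    apply: ler_sum => j _; apply: le_trans (ler_norm_expect _ _) _ => //.
    by apply: exit_term; rewrite -ltnS.
  (* First exits are disjoint, so [overshoot_bound] is paid once; only the exponentially small term
     is multiplied by the number of levels. *)
  rewrite big_split/= sumr_const card_ord -[X in _ + X]mulr_natl mulrCA lerD2r.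
  rewrite -big_distrr/= -expect_sum ler_piMr ?overshoot_ge0//.
  rewrite -[leRHS](expect_cst n 1 q1); apply: le_expect => // c.
  by rewrite exits_sum lerBlDr lerDl.
apply: le_trans (ler_norm_expect _ _) _ => //.
rewrite -(expect_cst n (2 * K%:R * expR (- (x ^+ 2 / a)) +
  2 * K%:R * (D * expR ((x + 1) * B + 1))) q1) -expectZ -expectD.
apply: le_expect => // c.
case: (boolP (stays lev q x c J.+1)) => [|_]; last first.
  rewrite mulr0 subrr normr0.
  have K2 : 0 <= 2 * K%:R :> R by rewrite mulr_ge0.
  have DE := mulr_ge0 D0 (expR_ge0 ((x + 1) * B + 1)).
  apply: addr_ge0 (mulr_ge0 K2 (ler0n _ _)).
  by apply: addr_ge0 (mulr_ge0 K2 DE); exact: mulr_ge0 K2 (expR_ge0 _).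
rewrite staysS => /andP[_ zx]; rewrite mulr1 distrC.
have zx1 : `|deviation lev q c J| <= x + 1 by apply: le_trans zx _; rewrite lerDl.
have A := approx (leqnn J) zx1.
set W := image_martingale _ _ _ _ in A *; set g := images _ _ _ _ in A.
have T : `|W - 1| <= `|W - g| + `|g - 1|.
  by have := ler_normD (W - g) (g - 1); rewrite addrA subrK.
have [xz|xz] := ltP (x / 2) `|deviation lev q c J|.
  have := images_inside K s0 x0 zx; rewrite -/g.
  have : 0 <= 2 * K%:R * expR (- (x ^+ 2 / a)) by rewrite !mulr_ge0// expR_ge0.
  by rewrite mulr1; lra.
have := images_center K s0 sa x0 xz; rewrite -/g mulr0; lra.
Qed.

End parameters.
End first_exit_asymptotics.

(** * Kolmogorov's series *)

Section kolmogorov_function.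
Variable R : realType.
Implicit Types (x y z : R) (K k : nat).

Definition kolmogorov_term x (j : int) : R :=
  (-1) ^ j * expR (- (2 * j%:~R ^+ 2 * x ^+ 2)).

Lemma kolmogorov_termP x k : kolmogorov_term x k = (-1) ^+ k * expR (- (2 * k%:R ^+ 2 * x ^+ 2)).
Proof. by []. Qed.

Lemma kolmogorov_termN x k :
  kolmogorov_term x (Negz k) = (-1) ^+ k.+1 * expR (- (2 * k.+1%:R ^+ 2 * x ^+ 2)).
Proof.
rewrite /kolmogorov_term; have -> : (-1) ^ Negz k = (-1) ^+ k.+1 :> R.
  by rewrite /exprz -exprVn invrN1.
by rewrite NegzE mulrNz sqrrN.
Qed.

(** As [k <= k^2], the terms are dominated by a geometric sequence whose ratio serves all [y >= x];
    this makes the tails uniform. *)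
Let term_le x y k : 0 <= x -> x <= y ->
  expR (- (2 * k%:R ^+ 2 * y ^+ 2)) <= expR (- (2 * x ^+ 2)) ^+ k.
Proof.
move=> x0 xy; rewrite -expRM_natl ler_expR mulrN lerN2.
have xy2 : x ^+ 2 <= y ^+ 2 by rewrite lerXn2r ?nnegrE// (le_trans x0).
have kk : k%:R <= k%:R ^+ 2 :> R by rewrite -natrX ler_nat; case: k => // k; rewrite leq_pmulr.
have -> : k%:R * (2 * x ^+ 2) = 2 * (k%:R * x ^+ 2) by ring.
by rewrite -mulrA ler_wpM2l// ler_pM// sqr_ge0.
Qed.

Lemma kolmogorov_partial_series K x : kolmogorov_partial K x =
  series (fun j => kolmogorov_term x (Posz j)) K.+1 +
  series (fun j => kolmogorov_term x (Negz j)) K.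
Proof.
rewrite /series/= big_nat_recl// !big_mkord kolmogorov_termP expr0 mul1r.
rewrite expr0n/= !(mulr0, mul0r) oppr0 expR0 /kolmogorov_partial -addrA; congr (1 + _).
rewrite -big_split/= big_distrr/=; apply: eq_bigr => k _.
by rewrite kolmogorov_termP kolmogorov_termN; ring.
Qed.

Let geo_lt1 x : 0 < x -> expR (- (2 * x ^+ 2)) < 1.
Proof. by move=> x0; rewrite expR_lt1 oppr_lt0 mulr_gt0// exprn_gt0. Qed.

Let cvg_terms x (a : nat -> R) : 0 < x ->
  (forall k, `|a k| <= expR (- (2 * x ^+ 2)) ^+ k) -> cvgn (series a).
Proof.
move=> x0 aB; apply: normed_cvg; apply: (@series_le_cvg _ _ (geometric 1 (expR (- (2 * x ^+ 2))))).
- by move=> k /=; exact: normr_ge0.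
- by move=> k; rewrite /geometric/= mul1r exprn_ge0// expR_ge0.
- by move=> k; rewrite /geometric/= mul1r.
- by apply: is_cvg_geometric_series; rewrite ger0_norm ?expR_ge0// geo_lt1.
Qed.

Lemma cvg_kolmogorov_partial x : 0 < x ->
  kolmogorov_partial K x @[K --> \oo] --> two_sided_series (kolmogorov_term x).
Proof.
move=> x0; have -> : (fun K => kolmogorov_partial K x) =
    (fun K => series (fun j => kolmogorov_term x (Posz j)) K.+1 +
       series (fun j => kolmogorov_term x (Negz j)) K).
  by apply/funext => K; exact: kolmogorov_partial_series.
apply: cvgD.
  rewrite (cvg_shiftS (series (fun j => kolmogorov_term x (Posz j)))).
  apply: (cvg_terms x0) => k; rewrite kolmogorov_termP normrM normrX normrN1 expr1n mul1r.
  by rewrite ger0_norm ?expR_ge0// term_le// ltW.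
apply: (cvg_terms x0) => k; rewrite kolmogorov_termN normrM normrX normrN1 expr1n mul1r.
rewrite ger0_norm ?expR_ge0// (le_trans (term_le _ (ltW x0) (lexx x)))//.
by rewrite exprS ler_piMl ?exprn_ge0 ?expR_ge0// ltW// geo_lt1.
Qed.

Let g x := expR (- (2 * x ^+ 2)).

Lemma kolmogorov_partial_tail x y K M : 0 < x -> x <= y ->
  `|kolmogorov_partial (K + M) y - kolmogorov_partial K y| <= 2 * g x ^+ K / (1 - g x).
Proof.
move=> x0 xy; have g1 := geo_lt1 x0; have g0 : 0 <= g x := expR_ge0 _.
rewrite /kolmogorov_partial big_split_ord/= opprD addrACA subrr add0r.
rewrite mulrDr addrAC subrr add0r normrM ger0_norm// -mulrA ler_wpM2l//.
apply: le_trans (ler_norm_sum _ _ _) _.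
apply: (@le_trans _ _ (\sum_(i < M) g x ^+ K * g x ^+ i)).
  apply: ler_sum => i _; rewrite normrM normrX normrN1 expr1n mul1r.
  rewrite ger0_norm ?expR_ge0// (le_trans (term_le _ (ltW x0) xy))// -exprD.
  by rewrite exprS ler_piMl ?exprn_ge0// ltW.
rewrite -big_distrr/= ler_wpM2l ?exprn_ge0//.
rewrite -[leRHS]mul1r ler_pdivlMr ?subr_gt0//.
have := subrX1 (g x) M; have := exprn_ge0 M g0.
by move: (\sum_(i < M) _) (g x ^+ M) => s gM; lra.
Qed.

Lemma kolmogorov_tail x y K : 0 < x -> x <= y ->
  `|two_sided_series (kolmogorov_term y) - kolmogorov_partial K y| <=
    2 * g x ^+ K / (1 - g x).
Proof.
move=> x0 xy; have y0 := lt_le_trans x0 xy.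
have C := cvg_kolmogorov_partial y0.
have {}C : `|kolmogorov_partial (K + M)%N y - kolmogorov_partial K y| @[M --> \oo] -->
    `|two_sided_series (kolmogorov_term y) - kolmogorov_partial K y|.
  apply: cvg_norm; apply: cvgB; last exact: cvg_cst.
  under eq_fun do rewrite addnC.
  by move: C; rewrite -(cvg_shiftn K (fun M => kolmogorov_partial M y)); exact.
rewrite -(cvg_lim _ C)//; apply: limr_le; first by apply/cvg_ex; eexists; exact: C.
by near=> M; exact: kolmogorov_partial_tail.
Unshelve. all: end_near. Qed.

(** The same truncation [K] must serve the tail of the series and the image surviving at the
    boundary. *)
Lemma kolmogorov_near x eps : 0 < x -> 0 < eps ->
  \forall K \near \oo, `|two_sided_series (kolmogorov_term x) - kolmogorov_partial K x| <= eps
   /\ expR (- (2 * K%:R * K.+1%:R * x ^+ 2)) <= eps.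
Proof.
move=> x0 e0; have := cvg_kolmogorov_partial x0 => /cvgrPdist_le/(_ _ e0) H.
near=> K; split; first by near: K.
have yK : eps^-1 / x ^+ 2 <= K%:R by near: K; exact: nbhs_infty_ger.
have x2 : 0 < x ^+ 2 by exact: exprn_gt0.
rewrite -[leRHS]invrK expRN lef_pV2 ?posrE ?invr_gt0 ?expR_gt0//.
apply: le_trans (expR_ge1Dx _).
move: yK; rewrite ler_pdivrMr// => yK.
have K1 : 1 <= K.+1%:R :> R by rewrite ler1n.
have Kx : 0 <= K%:R * x ^+ 2 by rewrite mulr_ge0// ltW.
have : K%:R * x ^+ 2 * 1 <= K%:R * x ^+ 2 * K.+1%:R by exact: ler_wpM2l.
lra.
Unshelve. all: end_near. Qed.

Let partial_dist K x y : `|kolmogorov_partial K x - kolmogorov_partial K y| <=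
  4 * K%:R ^+ 3 * `|x ^+ 2 - y ^+ 2|.
Proof.
rewrite /kolmogorov_partial opprD addrACA subrr add0r -mulrBr normrM ger0_norm// -sumrB.
have -> : 4 * K%:R ^+ 3 * `|x ^+ 2 - y ^+ 2| =
    2 * \sum_(k < K) (2 * K%:R ^+ 2 * `|x ^+ 2 - y ^+ 2|).
  by rewrite sumr_const card_ord -[in RHS]mulr_natl; ring.
rewrite ler_wpM2l//; apply: le_trans (ler_norm_sum _ _ _) _; apply: ler_sum => k _.
rewrite -mulrBr normrM normrX normrN1 expr1n mul1r.
have n0 (z : R) : - (2 * k.+1%:R ^+ 2 * z ^+ 2) <= 0.
  by rewrite oppr_le0; exact: mulr_ge0 (mulr_ge0 _ (sqr_ge0 _)) (sqr_ge0 _).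
apply: le_trans (ler_dist_expR (n0 x) (n0 y)) _; rewrite expR0 mulr1.
rewrite opprK addrC -mulrBr normrM distrC ger0_norm; last by rewrite mulr_ge0 ?sqr_ge0.
by rewrite ler_wpM2r// ler_wpM2l// lerXn2r ?nnegrE// ler_nat.
Qed.

(** Tails are uniformly small for [y >= x / 2], and partial sums are Lipschitz in [x^2]. Continuity
    allows [x] to be moved slightly when the supremum is replaced by a maximum over a grid. *)
Lemma kolmogorov_continuous x eps : 0 < x -> 0 < eps -> exists2 d, 0 < d &
  forall y, `|y - x| <= d ->
    `|two_sided_series (kolmogorov_term y) - two_sided_series (kolmogorov_term x)| <= eps.
Proof.
move=> x0 e0; have x20 : 0 < x / 2 by rewrite divr_gt0.
have g1 : g (x / 2) < 1 := geo_lt1 x20; have g0 : 0 <= g (x / 2) := expR_ge0 _.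
have [K HK] : exists K, 2 * g (x / 2) ^+ K / (1 - g (x / 2)) <= eps / 3.
  have C : 2 * g (x / 2) ^+ K / (1 - g (x / 2)) @[K --> \oo] --> 2 * 0 / (1 - g (x / 2)).
    apply: cvgMl; apply: cvgMr; apply: cvg_expr; by rewrite ger0_norm.
  move: C; rewrite mulr0 mul0r => /cvgrPdist_le/(_ (eps / 3)).
  rewrite divr_gt0// => /(_ isT)[K _ /(_ K (leqnn K))/=].
  by rewrite sub0r normrN => H; exists K; exact: le_trans (ler_norm _) H.
(* [3 * x] bounds [y + x], since [y <= x + x / 2]. *)
pose C := 4 * K%:R ^+ 3 * (3 * x).
have C0 : 0 <= C by rewrite !mulr_ge0// ?exprn_ge0// ltW.
exists (Num.min (x / 2) (eps / 3 / (C + 1))).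
  by rewrite lt_min x20 !divr_gt0//; lra.
move=> y; rewrite le_min => /andP[yx yC].
have /andP[y1 y2] : - (x / 2) <= y - x <= x / 2 by rewrite -ler_norml.
have T1 := kolmogorov_tail K x20 (_ : x / 2 <= y).
have {}T1 := le_trans (T1 (ltac:(lra))) HK.
have T2 := le_trans (kolmogorov_tail K x20 (_ : x / 2 <= x)) HK.
have {}T2 := T2 (ltac:(lra)).
have D : `|kolmogorov_partial K y - kolmogorov_partial K x| <= eps / 3.
  apply: le_trans (partial_dist K y x) _; rewrite subr_sqr normrM mulrCA.
  apply: (@le_trans _ _ (`|y - x| * C)).
    rewrite ler_wpM2l// /C ler_wpM2l ?mulr_ge0 ?exprn_ge0//.
    by rewrite ger0_norm; lra.
  apply: (@le_trans _ _ (eps / 3 / (C + 1) * C)); first by rewrite ler_wpM2r.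
  rewrite mulrAC ler_pdivrMr; last by lra.
  by apply: ler_wpM2l; lra.
move: T1 T2 D; rewrite !ler_norml => /andP[? ?] /andP[? ?] /andP[? ?].
by apply/andP; split; lra.
Qed.

End kolmogorov_function.

(** * The one-sample limit *)

Section reversal.
Variables (R : realType) (n : nat) (S : finType) (lev : S -> nat) (q : S -> R) (N : nat).
Hypotheses (q1 : \sum_s q s = 1) (levN : forall s, (lev s <= N)%N).
Implicit Types (j : nat) (c : {ffun 'I_n -> S}).

(** Time reversal: deviations merely change sign, level [j] going to [N - j - 1], and the end of the
    path becomes a beginning of small mass. *)
Definition reverse_level s : nat := (N - lev s)%N.

Lemma level_count_reverse c j : (j < N)%N ->
  level_count reverse_level c j = (n - level_count lev c (N - j.+1))%N.
Proof.
move=> jN; have := cardC [pred i | (lev (c i) <= N - j.+1)%N]; rewrite card_ord => H.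
rewrite -[X in (X - _)%N]H addKn; apply: eq_card => i; rewrite !inE /reverse_level.
by have := levN (c i); lia.
Qed.

Lemma level_cdf_reverse j : (j < N)%N ->
  level_cdf reverse_level q j = 1 - level_cdf lev q (N - j.+1).
Proof.
move=> jN; rewrite -(level_cdfC _ q1); apply: eq_bigl => s; rewrite /reverse_level.
by have := levN s; lia.
Qed.

Lemma level_mass_reverse j : (j <= N)%N ->
  level_mass reverse_level q j = level_mass lev q (N - j).
Proof.
move=> jN; apply: eq_bigl => s; rewrite /reverse_level.
by have := levN s; lia.
Qed.

Lemma level_mass_reverse_gt j : (N < j)%N -> level_mass reverse_level q j = 0.
Proof.
by move=> Nj; rewrite /level_mass big_pred0// => s; rewrite /reverse_level; lia.
Qed.

Lemma deviation_reverse c j : (j < N)%N ->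
  deviation reverse_level q c j = - deviation lev q c (N - j.+1).
Proof.
move=> jN; rewrite /deviation level_count_reverse// level_cdf_reverse//.
by rewrite natrB ?level_count_le//; ring.
Qed.

Lemma level_cdfN : level_cdf lev q N = 1.
Proof. by rewrite -[RHS]q1 /level_cdf; apply: eq_bigl => s; rewrite levN. Qed.

End reversal.

Section kolmogorov_limit.
Variable R : realType.

Lemma near_sqrt (A : R) : \forall n \near \oo, A <= Num.sqrt (n%:R : R).
Proof.
near=> n; have : A ^+ 2 <= n%:R by near: n; exact: nbhs_infty_ger.
move=> An; apply: le_trans (ler_norm A) _.
by rewrite -sqrtr_sqr ler_wsqrtr.
Unshelve. all: end_near. Qed.

(** From [exp y >= y^3 / 6] the left side is at most a multiple of [1 / sqrt n]. The factor [n]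
    stands for the number of levels in the union bounds. *)
Lemma near_poly_exp (eta A eps : R) : 0 < eta -> 0 < eps -> 0 <= A ->
  \forall n \near \oo, A * (n%:R * expR (- (eta * Num.sqrt n%:R))) <= eps.
Proof.
move=> eta0 eps0 A0; near=> n.
have : 1 + A * 6 / (eta ^+ 3 * eps) <= Num.sqrt (n%:R : R).
  by near: n; exact: near_sqrt.
set r := Num.sqrt _ => rA.
have rr : r ^+ 2 = n%:R by rewrite sqr_sqrtr.
have eta3 : 0 < eta ^+ 3 by exact: exprn_gt0.
have A3 : 0 <= A * 6 / (eta ^+ 3 * eps) by rewrite divr_ge0 ?mulr_ge0// ltW.
have r0 : 0 < r by lra.
have E : (eta * r) ^+ 3 / 6 <= expR (eta * r).
  have := @expR_ge1Dxn R (eta * r) 2 (mulr_ge0 (ltW eta0) (ltW r0)).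
  by rewrite (_ : 3`! = 6)%N//; lra.
rewrite expRN mulrA -rr ler_pdivrMr ?expR_gt0//.
apply: le_trans (ler_wpM2l (ltW eps0) E).
have : A * 6 / (eta ^+ 3 * eps) <= r by lra.
rewrite ler_pdivrMr ?mulr_gt0// => H.
have : A * 6 * r ^+ 2 <= r * (eta ^+ 3 * eps) * r ^+ 2 by rewrite ler_wpM2r// sqr_ge0.
rewrite exprMn; lra.
Unshelve. all: end_near. Qed.

Section one_sample.
Variables (n : nat) (S : finType) (lev : S -> nat) (q : S -> R) (N : nat).
Hypotheses (n0 : (0 < n)%N) (q0 : forall s, 0 <= q s) (q1 : \sum_s q s = 1).
Hypotheses (levN : forall s, (lev s <= N)%N).
Let r : R := Num.sqrt n%:R.
Implicit Type c : {ffun 'I_n -> S}.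

Let r0 : 0 < r. Proof. by rewrite sqrtr_gt0 ltr0n. Qed.

(** After reversal the levels from [J] to [N - 1] come first and carry mass at most [a], so
    [early_exit_prob] applies. *)
Lemma late_exit_prob (x t a eta : R) (m J : nat) : 0 < x -> 0 <= t -> 4 * t <= r ->
  (J < N)%N -> 1 - level_cdf lev q J <= a -> a <= 2^-1 ->
  (forall j, n%:R * level_mass lev q j <= eta * r) -> 0 <= eta ->
  m%:R / r + eta <= 1 ->
  expect q (fun c => (~~ [forall j : 'I_N, (J <= j)%N ==> (`|deviation lev q c j| <= x)%R])%:R) <=
    2 * expR (- (x * t - t ^+ 2 * a - (4 * (2 * t) ^+ 3 + (x + 1) * (2 * t) ^+ 2) / r))
    + N%:R * expR (6 * eta * r - m%:R).
Proof.
move=> x0 t0 tr JN pJ a2 meta eta0 m1.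
pose J' := (N - J.+1)%N.
have J'N : (J'.+1 <= N)%N by clear -JN; rewrite /J'; lia.
have revJ j : (j < N)%N -> (J <= j)%N -> (N - j.+1 < J'.+1)%N /\ (N - (N - j.+1).+1 = j)%N.
  by clear; rewrite /J'; lia.
have pJ' : level_cdf (reverse_level lev N) q J' <= a.
  rewrite level_cdf_reverse// (_ : N - J'.+1 = J)%N//.
  by clear -JN; rewrite /J'; lia.
have meta' j : n%:R * level_mass (reverse_level lev N) q j <= eta * r.
  have [jN|Nj] := leqP j N; first by rewrite level_mass_reverse.
  by rewrite level_mass_reverse_gt// mulr0 mulr_ge0// ltW.
have := early_exit_prob n0 q0 q1 x0 t0 tr pJ' a2 meta' eta0 m1.
move=> H; apply: le_trans (le_trans H _); last first.
  by rewrite lerD2l ler_wpM2r ?expR_ge0// ler_nat J'N.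
apply: le_expect => // c; rewrite ler_nat.
case: (boolP (stays _ _ _ _ _)) => [/staysP st|_]; last exact: leq_b1.
rewrite leqn0 eqb0 negbK; apply/forallP => j; apply/implyP => Jj.
have [jJ jE] := revJ j (ltn_ord j) Jj.
have := st _ jJ; rewrite deviation_reverse ?normrN ?jE//.
exact: leq_trans jJ J'N.
Qed.

(** Up to a level with remaining mass between [a / 2] and [a] the images give the answer; from there
    on the path rarely leaves even the strip of half-width [x / 2]. *)
Lemma stays_prob (x t a eta : R) (m K : nat) :
  let B := 2 * K%:R * x / (a / 2) in
  let D := (4 * B ^+ 3 + (x + 1) * B ^+ 2) / r in
  let D' := (4 * (2 * t) ^+ 3 + (x / 2 + 1) * (2 * t) ^+ 2) / r in
  let w := m%:R / r + eta in
  0 < x -> 0 <= t -> 0 < a -> a <= 2^-1 -> 2 * B <= r -> D <= 1 -> 4 * t <= r ->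
  (forall j, n%:R * level_mass lev q j <= eta * r) -> 0 <= eta -> eta / r <= a / 2 ->
  w <= 1 ->
  `|expect q (fun c => (stays lev q x c N)%:R) - kolmogorov_partial K x| <=
  (expR (- (2 * K%:R * K.+1%:R * x ^+ 2)) +
    2 * K%:R * (w * B * expR ((x + 1) * B)) +
    2 * (2 * K%:R * (D * expR ((x + 1) * B + 1)))) +
  (2 * (1 + 2 * K%:R)) * (N%:R * expR (6 * eta * r - m%:R)) +
  2 * K%:R * expR (- (x ^+ 2 / a)) +
  (1 + 2 * K%:R) * (2 * expR (- (x / 2 * t - t ^+ 2 * a - D'))).
Proof.
move=> B D D' w x0 t0 a0 a2 Br D1 tr meta eta0 etaa w1.
have rp := r0.
(* [J] is the first level with remaining mass at most [a]; as no level carries more than [a / 2], at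
   least [a / 2] remains. *)
have exJ : exists J, 1 - a <= level_cdf lev q J.
  by exists N; rewrite (level_cdfN q1 levN) gerBl ltW.
case: (ex_minnP exJ) => J pJ Jmin.
have massJ j : level_mass lev q j <= a / 2.
  apply: le_trans etaa; rewrite ler_pdivlMr//.
  have := meta j; have <- : r * r = n%:R by rewrite -expr2 sqr_sqrtr.
  by rewrite mulrC mulrA ler_pM2r.
have eJ : a / 2 <= 1 - level_cdf lev q J.
  case: J pJ Jmin => [|J] pJ Jmin.
    by rewrite level_cdf0; have := massJ 0%N; lra.
  rewrite level_cdfS; have := massJ J.+1.
  have : level_cdf lev q J < 1 - a.
    by rewrite ltNge; apply/negP => /Jmin; rewrite ltnn.
  lra.
have JN : (J < N)%N.
  rewrite ltnNge; apply/negP => NJ.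
  have := level_cdf_homo lev q0 NJ; rewrite (level_cdfN q1 levN); lra.
have a02 : 0 < a / 2 by rewrite divr_gt0.
have sJ : 1 - level_cdf lev q J <= a by lra.
have x2 : 0 < x / 2 by rewrite divr_gt0.
have F := first_exit_prob n0 q0 q1 x0 a02 eJ Br D1 meta eta0 w1 sJ.
have L := late_exit_prob x2 t0 tr JN sJ a2 meta eta0 w1.
(* The threshold [x / 2] lets one event cover both the exceptional positions at [J] and the exits
   after [J]. *)
set late := expect q _ in L.
have dJ : expect q (fun c => (x / 2 < `|deviation lev q c J|)%R%:R) <= late.
  apply: le_expect => // c; rewrite ler_nat.
  case: (ltP (x / 2) _) => // h; rewrite lt0b; apply/forallPn.
  by exists (Ordinal JN); rewrite /= leqnn/= -ltNge.
have st0 : expect q (fun c => (stays lev q x c N)%:R) <=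
    expect q (fun c => (stays lev q x c J.+1)%:R).
  apply: le_expect => // c; rewrite ler_nat.
  case: (boolP (stays lev q x c N)) => // /staysP st; rewrite lt0b.
  by apply/staysP => i iJ; apply: st; exact: leq_trans JN.
have st1 : expect q (fun c => (stays lev q x c J.+1)%:R) <=
    expect q (fun c => (stays lev q x c N)%:R) + late.
  rewrite -expectD; apply: le_expect => // c; rewrite -natrD ler_nat.
  case: (boolP (stays lev q x c J.+1)) => // /staysP st.
  case: (boolP [forall j : 'I_N, _]) => [/forallP lt|_]; last by rewrite addn1.
  rewrite addn0 lt0b; apply/staysP => i iN; have [iJ|Ji] := ltnP i J.+1; first exact: st.
  have /implyP/(_ (ltnW Ji)) := lt (Ordinal iN) => /le_trans; apply; lra.
have K2 : 0 <= 2 * K%:R :> R by rewrite mulr_ge0.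
have Nexp : J.+1%:R * expR (6 * eta * r - m%:R) <= N%:R * expR (6 * eta * r - m%:R).
  by rewrite ler_wpM2r ?expR_ge0// ler_nat.
have h1 := ler_wpM2l K2 dJ.
have h2 := ler_wpM2l (addr_ge0 ler01 K2) L.
have h3 := ler_wpM2l (addr_ge0 ler01 K2) Nexp.
move: F; rewrite -/r -/B -/D -/w => F.
have : `|expect q (fun c => (stays lev q x c N)%:R) - kolmogorov_partial K x| <=
  late + `|expect q (fun c => (stays lev q x c J.+1)%:R) - kolmogorov_partial K x|.
  set u := expect _ _ in st0 st1 *; set v := expect _ _ in st0 st1 *.
  rewrite -[u - _](subrK v) (_ : u - _ - v + v = (u - v) + (v - kolmogorov_partial K x)); last by ring.
  apply: le_trans (ler_normD _ _) _; rewrite lerD2r.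
  by rewrite ler_norml; apply/andP; split; lra.
move=> G; move: h1 h2 h3 F G; rewrite -/D'.
move: (kolmogorov_partial K x) (expR (- (2 * K%:R * K.+1%:R * x ^+ 2)))
  (expR ((x + 1) * B)) (expR ((x + 1) * B + 1)) (expR (- (x ^+ 2 / a)))
  (expR (- (x / 2 * t - t ^+ 2 * a - D'))) (expR (6 * eta * r - m%:R)).
move: (expect q (fun c => (x / 2 < _)%R%:R)) (expect q (fun c => (stays lev q x c J.+1)%:R))
  (expect q (fun c => (stays lev q x c N)%:R)) (K%:R : R) (J.+1%:R : R) (N%:R : R).
clear; move=> v1 v2 v3 v4 v5 v6 v7 v8 v9 v10 v11 v12 v13 h1 h2 h3.
move: `|_| `|_| => y1 y2; lra.
Qed.

End one_sample.
End kolmogorov_limit.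

(** The constant [eta] and the rank from which [n] is large depend on [x] and [eps] only, so the law
    may vary with [n] and with the path. Seven errors of size [eps / 8] are added up. *)
Theorem kolmogorov_uniform (R : realType) (x eps : R) : 0 < x -> 0 < eps ->
  exists2 eta : R, 0 < eta & \forall n \near \oo,
    forall (S : finType) (lev : S -> nat) (q : S -> R) (N : nat),
      (forall s, 0 <= q s) -> \sum_s q s = 1 -> (forall s, (lev s <= N)%N) ->
      (N <= 2 * n)%N ->
      (forall j, n%:R * level_mass lev q j <= eta * Num.sqrt n%:R) ->
      `|expect q (fun c : {ffun 'I_n -> S} => (stays lev q x c N)%:R) -
        two_sided_series (kolmogorov_term x)| <= eps.
Proof.
move=> x0 eps0; pose d := eps / 8; have d0 : 0 < d by rewrite divr_gt0.
have [K _ /(_ K (leqnn K))[HK1 HK2]] := kolmogorov_near x0 d0.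
have K0 : 0 <= K%:R :> R by [].
(* The choice [x t / 2 = A + 2] leaves an exponent at least [A] in the late exit bound, and
   [exp(- A) <= 1 / (1 + A)] brings its contribution below [d]. *)
pose A := (1 + 2 * K%:R) * 2 / d.
have A0 : 0 <= A by rewrite divr_ge0// ?mulr_ge0 ?addr_ge0 ?mulr_ge0// ltW.
pose t := 2 * (A + 2) / x.
have t0 : 0 <= t by rewrite divr_ge0 ?(ltW x0)// mulr_ge0// addr_ge0.
have xt : x / 2 * t = A + 2 by rewrite /t; field; rewrite gt_eqF.
(* The three bounds serve the maximal inequality, the estimate [t^2 a <= 1] and, through
   [exp(- y) <= 1 / y], the smallness of the images at level [J]. *)
pose a := Num.min 2^-1 (Num.min (t ^+ 2 + 1)^-1 (d * x ^+ 2 / (2 * K%:R + 1))).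
have t21 : 0 < t ^+ 2 + 1 by rewrite ltr_wpDl// sqr_ge0.
have K21 : 0 < 2 * K%:R + 1 :> R by rewrite ltr_wpDl// mulr_ge0.
have x20 : 0 < x ^+ 2 by exact: exprn_gt0.
have a0 : 0 < a.
  by rewrite !lt_min !invr_gt0 t21 ltr0n/= divr_gt0// mulr_gt0.
have a2 : a <= 2^-1 by rewrite ge_min lexx.
have at1 : t ^+ 2 * a <= 1.
  apply: (@le_trans _ _ (t ^+ 2 / (t ^+ 2 + 1))).
    by rewrite ler_wpM2l ?sqr_ge0// !ge_min lexx orbT.
  by rewrite ler_pdivrMr// mul1r lerDl.
have aK : 2 * K%:R * expR (- (x ^+ 2 / a)) <= d.
  have y0 : 0 < x ^+ 2 / a by rewrite divr_gt0.
  apply: (@le_trans _ _ (2 * K%:R * (x ^+ 2 / a)^-1)).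
    rewrite ler_wpM2l ?mulr_ge0// expRN lef_pV2 ?posrE ?expR_gt0//.
    by have := expR_ge1Dx (x ^+ 2 / a); lra.
  rewrite invf_div mulrA ler_pdivrMr//.
  apply: (@le_trans _ _ (2 * K%:R * (d * x ^+ 2 / (2 * K%:R + 1)))).
    by rewrite ler_wpM2l ?mulr_ge0// !ge_min lexx !orbT.
  rewrite mulrA ler_pdivrMr//.
  have : 0 <= d * x ^+ 2 by rewrite mulr_ge0// ltW.
  lra.
pose B := 2 * K%:R * x / (a / 2).
have B0 : 0 <= B by rewrite divr_ge0 ?divr_ge0 ?mulr_ge0// ltW.
pose EB := expR ((x + 1) * B); pose EB1 := expR ((x + 1) * B + 1).
have EB0 : 0 <= EB by exact: expR_ge0.
have EB10 : 0 <= EB1 by exact: expR_ge0.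
pose C1 := 2 * K%:R * (9 * B * EB).
have C10 : 0 <= C1 by exact: mulr_ge0 (mulr_ge0 _ K0) (mulr_ge0 (mulr_ge0 _ B0) EB0).
(* The overshoot will be at most [9 eta]: a jump below [m] contributes at most
   [7 eta + 1 / r <= 8 eta], the mass of the level one more [eta]. *)
pose eta := Num.min 9^-1 (d / (C1 + 1)).
have C11 : 0 < C1 + 1 by rewrite ltr_wpDl.
have eta0 : 0 < eta by rewrite lt_min invr_gt0 ltr0n/= divr_gt0.
have eta9 : eta <= 9^-1 by rewrite ge_min lexx.
have etaC : C1 * eta <= d.
  apply: (@le_trans _ _ (C1 * (d / (C1 + 1)))).
    by rewrite ler_wpM2l// ge_min lexx orbT.
  rewrite mulrA ler_pdivrMr// mulrC ler_wpM2l ?(ltW d0)//; lra.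
exists eta => //.
pose Cd := 4 * B ^+ 3 + (x + 1) * B ^+ 2.
pose Ct := 4 * (2 * t) ^+ 3 + (x / 2 + 1) * (2 * t) ^+ 2.
have Cd0 : 0 <= Cd.
  by rewrite addr_ge0// mulr_ge0 ?exprn_ge0// addr_ge0// ltW.
near=> n.
have r1 : 1 <= Num.sqrt (n%:R : R) by near: n; exact: near_sqrt.
have rB : 2 * B <= Num.sqrt (n%:R : R) by near: n; exact: near_sqrt.
have rt : 4 * t <= Num.sqrt (n%:R : R) by near: n; exact: near_sqrt.
have rCd : Cd <= Num.sqrt (n%:R : R) by near: n; exact: near_sqrt.
have rCt : Ct <= Num.sqrt (n%:R : R) by near: n; exact: near_sqrt.
have reta : eta / (a / 2) <= Num.sqrt (n%:R : R) by near: n; exact: near_sqrt.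
have reta' : eta^-1 <= Num.sqrt (n%:R : R) by near: n; exact: near_sqrt.
have rD : 2 * (2 * K%:R * (Cd * EB1)) / d <= Num.sqrt (n%:R : R) by near: n; exact: near_sqrt.
have rN : 2 * (1 + 2 * K%:R) * 2 * (n%:R * expR (- (eta * Num.sqrt (n%:R : R)))) <= d.
  near: n; apply: near_poly_exp => //.
move=> S lev q N q0 q1 levN Nn.
move: r1 rB rt rCd rCt reta reta' rD rN; set r := Num.sqrt n%:R.
move=> r1 rB rt rCd rCt reta reta' rD rN meta.
have r0 : 0 < r by exact: lt_le_trans r1.
have n0 : (0 < n)%N.
  by rewrite -(@ltr0n R) -(sqr_sqrtr (ler0n R n)) exprn_gt0.
(* Just above [7 eta r], so that [6 eta r - m <= - eta r] in the union bounds. *)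
pose m := (Num.truncn (7 * eta * r)).+1.
have y0 : 0 <= 7 * eta * r by rewrite !mulr_ge0// ltW.
have /andP[m1 m2] := truncn_itv y0.
have {}m2 : 7 * eta * r <= m%:R by exact: ltW.
have m3 : m%:R <= 7 * eta * r + 1 by rewrite /m -natr1 lerD2r.
have ie : r^-1 <= eta by rewrite -[eta]invrK lef_pV2 ?posrE ?invr_gt0.
have w9 : m%:R / r + eta <= 9 * eta.
  have : m%:R / r <= 7 * eta + r^-1.
    by rewrite ler_pdivrMr// mulrDl mulVf ?gt_eqF.
  by clear -ie; lra.
have w1 : m%:R / r + eta <= 1 by clear -w9 eta9; lra.
have D1 : Cd / r <= 1 by rewrite ler_pdivrMr// mul1r.
have D'1 : Ct / r <= 1 by rewrite ler_pdivrMr// mul1r.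
have ea : eta / r <= a / 2.
  by rewrite ler_pdivrMr// mulrC -ler_pdivrMr// divr_gt0.
have St := stays_prob n0 q0 q1 levN x0 t0 a0 a2 rB D1 rt meta (ltW eta0) ea w1 (K := K).
rewrite -/r -/B -/Cd -/Ct -/EB -/EB1 in St.
have b2 : 2 * K%:R * ((m%:R / r + eta) * B * EB) <= d.
  apply: le_trans etaC; rewrite /C1 -[leRHS]mulrA ler_wpM2l ?mulr_ge0//.
  rewrite [leRHS](_ : _ = 9 * eta * B * EB); last by ring.
  by apply: ler_wpM2r => //; exact: ler_wpM2r.
have b3 : 2 * (2 * K%:R * (Cd / r * EB1)) <= d.
  have -> : 2 * (2 * K%:R * (Cd / r * EB1)) = 2 * (2 * K%:R * (Cd * EB1)) / r.
    by field; rewrite gt_eqF.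
  by rewrite ler_pdivrMr// [leRHS]mulrC -ler_pdivrMr.
have b4 : 2 * (1 + 2 * K%:R) * (N%:R * expR (6 * eta * r - m%:R)) <= d.
  apply: le_trans rN; rewrite -[leRHS]mulrA ler_wpM2l//.
  rewrite mulrA ler_pM ?expR_ge0//; first by rewrite -natrM ler_nat.
  by rewrite ler_expR; clear -m2; lra.
have b5 : (1 + 2 * K%:R) * (2 * expR (- (x / 2 * t - t ^+ 2 * a - Ct / r))) <= d.
  have E : expR (- (x / 2 * t - t ^+ 2 * a - Ct / r)) <= (1 + A)^-1.
    rewrite expRN lef_pV2 ?posrE ?expR_gt0//; last by clear -A0; lra.
    by apply: le_trans (expR_ge1Dx _); move: xt at1 D'1; clear; lra.
  apply: (@le_trans _ _ ((1 + 2 * K%:R) * (2 * (1 + A)^-1))).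
    by rewrite ler_wpM2l ?ler_wpM2l// addr_ge0// mulr_ge0.
  rewrite mulrA ler_pdivrMr; last by clear -A0; lra.
  have -> : (1 + 2 * K%:R) * 2 = d * A by rewrite /A; field; rewrite gt_eqF.
  by rewrite ler_wpM2l ?(ltW d0)// lerDr.
have dE : eps = 8 * d by rewrite /d; field.
set P := expect _ _ in St *; set H := kolmogorov_partial K x in St HK1.
have -> : P - two_sided_series (kolmogorov_term x) =
    (P - H) - (two_sided_series (kolmogorov_term x) - H) by ring.
apply: le_trans (ler_normB _ _) _.
move: HK1 HK2 St aK b2 b3 b4 b5; rewrite dE.
move: `|P - H| `|_ - H| => y1 y2; clear -d0; lra.
Unshelve. all: end_near. Qed.

(** * From samples to levels *)

Section grid.
Variable R : realType.
Implicit Types (Y : nat -> R) (v : R) (N j : nat).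

(* The index of the first cell [[0, Y j]] containing [v], or [N.+1]. *)
Definition grid_level N Y v : 'I_N.+2 :=
  inord (seq.find (fun j => 0 <= v <= Y j) (iota 0 N.+1)).

Lemma grid_level_le N Y v j :
  (forall i i', (i <= i' <= N)%N -> Y i <= Y i') -> (j <= N)%N ->
  (grid_level N Y v <= j)%N = (0 <= v <= Y j).
Proof.
move=> Yh jN; rewrite inordK; last first.
  by have := find_size (fun j => 0 <= v <= Y j) (iota 0 N.+1); rewrite size_iota ltnS.
set f := seq.find _ _; apply/idP/idP => [fj|vj].
  have hf : has (fun j => 0 <= v <= Y j) (iota 0 N.+1).
    by rewrite has_find size_iota -/f; lia.
  have := nth_find 0%N hf; rewrite -/f nth_iota; last by lia.
  by rewrite add0n => /andP[-> vf]; rewrite (le_trans vf)// Yh// fj.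
rewrite leqNgt; apply/negP => jf.
by have := before_find 0%N jf; rewrite nth_iota ?vj//; lia.
Qed.

Lemma measurable_grid_level N Y (s : 'I_N.+2) :
  (forall i i', (i <= i' <= N)%N -> Y i <= Y i') ->
  measurable [set v | grid_level N Y v = s].
Proof.
move=> Yh; have mle j : measurable [set v | (grid_level N Y v <= j)%N].
  have [jN|Nj] := leqP j N; last first.
    rewrite (_ : mkset _ = setT) //; apply/seteqP; split => // v _ /=.
    by rewrite (leq_trans _ Nj)// -ltnS.
  rewrite (_ : mkset _ = `[0, Y j]%classic) //; apply/seteqP; split => v /=.
    by rewrite grid_level_le// in_itv.
  by rewrite grid_level_le// in_itv.
case: (posnP s) => [s0|s0].
  rewrite (_ : mkset _ = [set v | (grid_level N Y v <= 0)%N]) //.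
  apply/seteqP; split => v /=; first by move=> ->; rewrite s0.
  by move=> h; apply/val_inj; rewrite /= s0; apply/eqP; rewrite -leqn0.
rewrite (_ : mkset _ = [set v | (grid_level N Y v <= s)%N] `\`
    [set v | (grid_level N Y v <= s.-1)%N]); first exact: measurableD.
apply/seteqP; split => v /=; first by move=> ->; split => //; lia.
by move=> [h1 h2]; apply/val_inj => /=; lia.
Qed.

End grid.

Lemma measurable_finite_valued d (T : measurableType d) (S : finType) (L : T -> S)
    (Q : pred S) :
  (forall s, measurable [set w | L w = s]) -> measurable [set w | Q (L w)].
Proof.
move=> mL; have -> : [set w | Q (L w)] = \bigcup_(s in [set` Q]) [set w | L w = s].
  by apply/seteqP; split => [w Qw|w [s Qs /= ->]//]; exists (L w).
exact: fin_bigcup_measurable.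
Qed.

Lemma measure_finite_valued d (T : measurableType d) (R : realType)
    (mu : {measure set T -> \bar R}) (S : finType) (L : T -> S) (Q : pred S) :
  (forall s, measurable [set w | L w = s]) ->
  mu [set w | Q (L w)] = (\sum_(s | Q s) mu [set w | L w = s])%E.
Proof.
move=> mL; have -> : [set w | Q (L w)] = \bigcup_(s in [set` Q]) [set w | L w = s].
  by apply/seteqP; split => [w Qw|w [s Qs /= ->]//]; exists (L w).
rewrite measure_fin_bigcup//.
- by rewrite -(bigfs _ (index_enum_uniq S))// => i _; rewrite mem_index_enum.
- by apply/trivIsetP => i j _ _ ij; apply/seteqP; split => // w /= [Li Lj]; move: ij; rewrite -Li -Lj eqxx.
Qed.

Section iid_levels.
Context d (T : measurableType d) (R : realType) (P : probability T R).
Variables (n : nat) (V : 'I_n -> T -> R) (V0 : T -> R) (N : nat) (Y : nat -> R).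
Hypotheses (mV : forall i, measurable_fun setT (V i)) (mV0 : measurable_fun setT V0).
Hypothesis indep : forall B : 'I_n -> set R, (forall i, measurable (B i)) ->
  P (\bigcap_i (V i @^-1` B i)) = (\prod_i P (V i @^-1` B i))%E.
Hypothesis ident : forall i (B : set R), measurable B -> P (V i @^-1` B) = P (V0 @^-1` B).
Hypothesis Yh : forall i i', (i <= i' <= N)%N -> Y i <= Y i'.

Definition level_weight (s : 'I_N.+2) : R := fine (P [set w | grid_level N Y (V0 w) = s]).

Let mlev (W : T -> R) s : measurable_fun setT W ->
  measurable [set w | grid_level N Y (W w) = s].
Proof.
move=> mW; rewrite -[X in measurable X]setTI.
exact: (mW measurableT _ (measurable_grid_level s Yh)).
Qed.

Lemma level_weight_ge0 s : 0 <= level_weight s.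
Proof. by rewrite fine_ge0. Qed.

Let weightE s : P [set w | grid_level N Y (V0 w) = s] = (level_weight s)%:E.
Proof. by rewrite fineK// fin_num_measure//; exact: mlev. Qed.

Lemma level_weight_sum (Q : pred 'I_N.+2) :
  \sum_(s | Q s) level_weight s = fine (P [set w | Q (grid_level N Y (V0 w))]).
Proof.
rewrite (@measure_finite_valued _ _ _ _ _ (fun w => grid_level N Y (V0 w))); last first.
  by move=> s; exact: mlev.
by rewrite (eq_bigr (fun s => (level_weight s)%:E)) ?sumEFin// => s _; exact: weightE.
Qed.

Lemma level_weight1 : \sum_s level_weight s = 1.
Proof.
rewrite (level_weight_sum xpredT) (_ : mkset _ = setT) ?probability_setT//.
by apply/seteqP; split.
Qed.

Lemma level_weight_cdf j : (j <= N)%N ->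
  level_cdf (fun s : 'I_N.+2 => s : nat) level_weight j = fine (P (V0 @^-1` `[0, Y j])).
Proof.
move=> jN; rewrite /level_cdf level_weight_sum; congr (fine (P _)).
by apply/seteqP; split => w /=; rewrite grid_level_le// in_itv.
Qed.

Let levelsE c : [set w | [ffun i => grid_level N Y (V i w)] = c] =
    \bigcap_i (V i @^-1` [set v | grid_level N Y v = c i]).
Proof.
apply/seteqP; split => [w <- i _ /=|w H]; first by rewrite ffunE.
by apply/ffunP => i; rewrite ffunE; exact: H.
Qed.

Let mlevels c : measurable [set w | [ffun i => grid_level N Y (V i w)] = c].
Proof.
by rewrite levelsE; apply: fin_bigcap_measurable => // i _; exact: mlev.
Qed.

Lemma measurable_levels (G : {ffun 'I_n -> 'I_N.+2} -> bool) :
  measurable [set w | G [ffun i => grid_level N Y (V i w)]].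
Proof.
exact: (measurable_finite_valued (L := fun w => [ffun i => grid_level N Y (V i w)])).
Qed.

(** Independence and the common law give the vector of levels a product weight, which turns [P] into
    a finite sum. *)
Lemma prob_levels (G : {ffun 'I_n -> 'I_N.+2} -> bool) :
  P [set w | G [ffun i => grid_level N Y (V i w)]] =
  (expect level_weight (fun c => (G c)%:R))%:E.
Proof.
rewrite (@measure_finite_valued _ _ _ _ _ (fun w => [ffun i => grid_level N Y (V i w)]))//.
rewrite /expect -sumEFin big_mkcond/=; apply: eq_bigr => c _.
case: ifPn => _; last by rewrite mulr0.
rewrite mulr1 levelsE indep; last by move=> i; exact: measurable_grid_level.
rewrite -prodEFin; apply: eq_bigr => i _.
by rewrite ident ?weightE//; exact: measurable_grid_level.
Qed.

End iid_levels.

(** * Suprema over a grid of quantiles *)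

Definition quantile_grid (R : realType) (F : R -> R) (N : nat) (Y : nat -> R) :=
  [/\ Y 0 = 0, Y N = 1, forall i j, (i <= j <= N)%N -> Y i <= Y j &
      forall j, (j <= N)%N -> F (Y j) = j%:R / N%:R].

(** Interior points come from the intermediate value theorem and are ordered because [F] separates
    them. The endpoints are prescribed, as [F] may be flat near [0] or [1]. *)
Lemma quantile_gridP (R : realType) (F : R -> R) (N : nat) :
  continuous F -> {homo F : x y / x <= y} -> F 0 = 0 -> F 1 = 1 -> (0 < N)%N ->
  exists Y, quantile_grid F N Y.
Proof.
move=> Fc Fh F0 F1 N0; have N0' : 0 < N%:R :> R by rewrite ltr0n.
have ex (j : nat) : exists y : R, [/\ (j <= N)%N -> F y = j%:R / N%:R, 0 <= y <= 1,
    j = 0 -> y = 0 & j = N -> y = 1].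
  have [->|j0] := eqVneq j 0.
    exists 0; split => //; [by rewrite F0 mul0r|by rewrite lexx ler01|].
    by move=> N0e; rewrite -N0e in N0.
  have [->|jN] := eqVneq j N.
    exists 1; split => //; [by rewrite F1 divff// gt_eqF|by rewrite ler01 lexx|].
    by move=> N0e; rewrite N0e in N0.
  (* Indices beyond [N] get the dummy value [0]. *)
  have [jN'|Nj] := leqP j N; last first.
    exists 0; split.
    - by [].
    - by rewrite lexx ler01.
    - by [].
    - by move=> /eqP; rewrite (negPf jN).
  have vb : Num.min (F 0) (F 1) <= j%:R / N%:R <= Num.max (F 0) (F 1).
    rewrite F0 F1 min_l// max_r// divr_ge0//= ler_pdivrMr// mul1r ler_nat//.
  have [y y01 Fy] := IVT ler01 (continuous_subspaceT Fc) vb.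
  exists y; split.
  - by [].
  - by move: y01; rewrite in_itv.
  - by move=> /eqP; rewrite (negPf j0).
  - by move=> /eqP; rewrite (negPf jN).
have [Y HY] := choice ex; exists Y.
have Y01 j : 0 <= Y j <= 1 by have [] := HY j.
split.
- by have [_ _ + _] := HY 0; exact.
- by have [_ _ _] := HY N; exact.
- move=> i j /andP[]; rewrite leq_eqVlt => /orP[/eqP->//|ij] jN.
  rewrite leNgt; apply/negP => ji; have := Fh _ _ (ltW ji).
  have [Fi _ _ _] := HY i; have [Fj _ _ _] := HY j.
  rewrite Fj// Fi ?(leq_trans (ltnW ij))//.
  by rewrite ler_pM2r ?invr_gt0// ler_nat leqNgt ij.
- by move=> j jN; have [H _ _ _] := HY j; exact: H.
Qed.

Section sup01.
Variables (R : realType) (F g : R -> R) (c : R).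
Hypotheses (Fh : {homo F : x y / x <= y}) (F0 : F 0 = 0) (F1 : F 1 = 1) (c0 : 0 <= c).
Hypothesis gh : forall x y, 0 <= x -> x <= y -> y <= 1 -> g x <= g y.

Let D (y : R) : R := `|c * (g y - F y)|.

(** [sup] is meaningful only for bounded sets; monotonicity places [g y] between [g 0] and [g 1],
    and [F y] in [[0, 1]]. *)
Lemma le_sup01 y : 0 <= y <= 1 -> D y <= sup01 D.
Proof.
move=> /andP[y0 y1]; apply: ub_le_sup; last by exists y; rewrite //= in_itv/= y0.
exists (c * (`|g 0| + `|g 1| + 1)) => _ [z /= zI <-]; move: zI; rewrite in_itv/= => /andP[z0 z1].
rewrite /D normrM (ger0_norm c0) ler_wpM2l//.
have := gh (lexx 0) z0 z1; have := gh z0 z1 (lexx 1).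
have := Fh z0; have := Fh z1; rewrite F0 F1.
have := ler_norm (g 1); have := ler_norm (- g 0); rewrite normrN.
have := normr_ge0 (g 0); have := normr_ge0 (g 1).
by rewrite ler_norml => *; apply/andP; split; lra.
Qed.

(** Between neighbouring grid points both functions are monotone and [F] gains exactly [1 / N], so
    interpolation costs at most [c / N]. *)
Lemma sup01_le_grid (N : nat) (Y : nat -> R) (M : R) : (0 < N)%N ->
  quantile_grid F N Y -> (forall j, (j <= N)%N -> D (Y j) <= M) ->
  sup01 D <= M + c / N%:R.
Proof.
move=> N0 [Y0 YN Yh FY] DM; apply: ge_sup; first by exists (D 0), 0; rewrite //= in_itv/= lexx ler01.
move=> _ [y /= yI <-]; move: yI; rewrite in_itv/= => /andP[y0 y1].
have Y01 j : (j <= N)%N -> 0 <= Y j <= 1.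
  by move=> jN; rewrite -Y0 -YN !Yh//= ?jN ?leqnn.
have ex : exists j, y <= Y j by exists N; rewrite YN.
case: (ex_minnP ex) => j yj jmin.
have jN : (j <= N)%N by apply: jmin; rewrite YN.
have cN : 0 <= c / N%:R by rewrite divr_ge0.
have DM' i : (i <= N)%N -> - M <= c * (g (Y i) - F (Y i)) <= M.
  by move=> /DM; rewrite /D ler_norml.
rewrite /D ler_norml; case: j => [|j] in yj jmin jN *.
  have {yj} -> : y = Y 0 by apply/eqP; rewrite eq_le yj Y0.
  by have /andP[? ?] := DM' 0%N (leq0n _); apply/andP; split; lra.
have jy : Y j <= y by rewrite leNgt; apply/negP => /ltW/jmin; rewrite ltnn.
have /andP[l1 u1] := DM' j.+1 jN; have /andP[l0 u0] := DM' j (ltnW jN).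
have /andP[Yj0 _] := Y01 j (ltnW jN); have /andP[_ Yj1] := Y01 _ jN.
have g1 : c * g y <= c * g (Y j.+1) by rewrite ler_wpM2l// gh.
have g0 : c * g (Y j) <= c * g y by rewrite ler_wpM2l// gh.
have f1 : c * F y <= c * F (Y j.+1) by rewrite ler_wpM2l// Fh.
have f0 : c * F (Y j) <= c * F y by rewrite ler_wpM2l// Fh.
have st : c * F (Y j.+1) = c * F (Y j) + c / N%:R.
  rewrite !FY//; last exact: ltnW.
  by rewrite -natr1; ring.
rewrite !mulrBr in l0 u0 l1 u1 *; apply/andP; split; lra.
Qed.

End sup01.

Section measurable_sup01.
Context d (T : measurableType d) (R : realType).
Variables (F : R -> R) (g : T -> R -> R) (c : R).
Hypotheses (Fc : continuous F) (Fh : {homo F : x y / x <= y}).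
Hypotheses (F0 : F 0 = 0) (F1 : F 1 = 1) (c0 : 0 <= c).
Hypothesis gh : forall w x y, 0 <= x -> x <= y -> y <= 1 -> g w x <= g w y.
Hypothesis mg : forall y, 0 <= y <= 1 -> measurable_fun setT (g ^~ y).

(** The grids of all sizes [N + 1] together are countable, and the loss [c / (N + 1)] of each is
    arbitrarily small. *)
Lemma measurable_sup01_le x :
  measurable [set w | sup01 (fun y => `|c * (g w y - F y)|) <= x].
Proof.
have [Y HY] := choice (fun N => quantile_gridP Fc Fh F0 F1 (ltn0Sn N)).
have Y01 N j : (j <= N.+1)%N -> 0 <= Y N j <= 1.
  move=> jN; have [Y0 YN Yh _] := HY N.
  by apply/andP; split; [rewrite -Y0|rewrite -YN]; apply: Yh; rewrite ?jN ?leqnn.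
have -> : [set w | sup01 (fun y => `|c * (g w y - F y)|) <= x] =
    \bigcap_N \bigcap_(j in [set j | (j <= N.+1)%N])
      [set w | `|c * (g w (Y N j) - F (Y N j))| <= x].
  apply/seteqP; split => w /=.
    move=> h N _ j /= jN; apply: le_trans h.
    exact: (le_sup01 Fh F0 F1 c0 (gh w) (Y01 N j jN)).
  move=> h; apply/ler_addgt0Pr => e e0.
  have [N Ne] : exists N, c / N.+1%:R <= e.
    exists (Num.truncn (c / e)); rewrite ler_pdivrMr// mulrC -ler_pdivrMr//.
    by apply/ltW/truncnS_gt.
  apply: le_trans (_ : _ <= x + c / N.+1%:R) _; last by rewrite lerD2l.
  apply: (sup01_le_grid Fh c0 (gh w) (ltn0Sn N) (HY N)) => j jN.
  exact: h.
apply: bigcapT_measurable => N; apply: bigcap_measurableType => j /= jN.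
rewrite -[X in measurable X]setTI.
have m : measurable_fun setT (fun w => `|c * (g w (Y N j) - F (Y N j))|).
  apply: measurableT_comp => //; apply: measurable_funM => //.
  by apply: measurable_funB => //; exact/mg/Y01.
rewrite (_ : mkset _ = (fun w => `|c * (g w (Y N j) - F (Y N j))|) @^-1` `]-oo, x]).
  exact: m.
by apply/seteqP; split => w /=; rewrite in_itv.
Qed.

(** Convergence in probability speaks of events of this form; the exceptional set of paths is one of
    them. *)
Lemma measurable_sup01_ge x :
  measurable [set w | x <= sup01 (fun y => `|c * (g w y - F y)|)].
Proof.
rewrite (_ : mkset _ = \bigcap_k
    ~` [set w | sup01 (fun y => `|c * (g w y - F y)|) <= x - k.+1%:R^-1]).
  by apply: bigcapT_measurable => k; apply: measurableC; exact: measurable_sup01_le.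
apply/seteqP; split => w /= h.
  move=> k _ /=; apply/negP; rewrite -ltNge; apply: lt_le_trans h.
  by rewrite ltrBlDr ltrDl invr_gt0.
apply/ler_addgt0Pr => e e0.
have [k ke] : exists k, k.+1%:R^-1 <= e.
  exists (Num.truncn e^-1); rewrite -[leRHS]invrK lef_pV2 ?posrE ?invr_gt0//.
  by apply/ltW/truncnS_gt.
have := h k I => /negP; rewrite -ltNge => /ltW H.
rewrite -lerBlDr; apply: le_trans H; by rewrite lerD2l lerN2.
Qed.

End measurable_sup01.

(** * Kolmogorov's theorem for real i.i.d. samples *)

Lemma empirical_cdf_homo (R : realType) (n : nat) (z : 'I_n -> R) (x y : R) :
  x <= y -> empirical_cdf z x <= empirical_cdf z y.
Proof.
move=> xy; rewrite /empirical_cdf ler_wpM2l ?invr_ge0//.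
apply: ler_sum => i _; rewrite !indicE ler_nat.
case: (boolP (z i \in `[0, x]%classic)) => //.
rewrite !inE/= !in_itv/= => /andP[z0 zx].
by rewrite mem_set//= in_itv/= z0 (le_trans zx).
Qed.

Lemma empirical_cdf_level (R : realType) (n : nat) (z : 'I_n -> R) N Y j :
  (forall i i', (i <= i' <= N)%N -> Y i <= Y i') -> (j <= N)%N ->
  empirical_cdf z (Y j) =
  n%:R^-1 * (level_count (fun s : 'I_N.+2 => s : nat)
    [ffun i => grid_level N Y (z i)] j)%:R.
Proof.
move=> Yh jN; rewrite /empirical_cdf; congr (_ * _).
rewrite /level_count -sum1_card natr_sum [RHS]big_mkcond/=; apply: eq_bigr => i _.
rewrite inE ffunE grid_level_le// indicE.
case: (boolP (0 <= z i <= Y j)) => h; first by rewrite mem_set//= in_itv.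
by rewrite memNset//= in_itv; apply/negP.
Qed.

(** Closeness to [F] at the quantiles [j / n] bounds the mass of each cell by
    [1 / n + 2 delta / sqrt n]. The event then lies between staying within [x - d'] and staying
    within [x + d'], and continuity of the limit concludes. *)
Theorem kolmogorov_iid (R : realType) (F : R -> R) (x eps : R) :
  continuous F -> {homo F : x y / x <= y} -> F 0 = 0 -> F 1 = 1 -> 0 < x -> 0 < eps ->
  exists2 delta : R, 0 < delta & \forall n \near \oo,
    forall d (T : measurableType d) (P : probability T R) (V : 'I_n -> T -> R)
      (V0 : T -> R) (Y : nat -> R),
    (forall i, measurable_fun setT (V i)) -> measurable_fun setT V0 ->
    (forall B : 'I_n -> set R, (forall i, measurable (B i)) ->
      P (\bigcap_i (V i @^-1` B i)) = (\prod_i P (V i @^-1` B i))%E) ->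
    (forall i (B : set R), measurable B -> P (V i @^-1` B) = P (V0 @^-1` B)) ->
    quantile_grid F n Y ->
    (forall j, (j <= n)%N ->
      `|fine (P (V0 @^-1` `[0, Y j])) - F (Y j)| <= delta / Num.sqrt n%:R) ->
    `|fine (P [set w | sup01 (fun y =>
        `|Num.sqrt n%:R * (empirical_cdf (V ^~ w) y - F y)|) <= x]) -
      two_sided_series (kolmogorov_term x)| <= eps.
Proof.
move=> Fc Fh F0 F1 x0 eps0; have e2 : 0 < eps / 2 by rewrite divr_gt0.
have [d1 d10 Kc] := kolmogorov_continuous x0 e2.
pose d' := Num.min d1 (x / 2).
have d'0 : 0 < d' by rewrite lt_min d10 divr_gt0.
have d'1 : d' <= d1 by rewrite ge_min lexx.
have d'x : d' <= x / 2 by rewrite ge_min lexx orbT.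
have xm : 0 < x - d' by lra.
have xp : 0 < x + d' by lra.
pose good (eta y : R) (n : nat) :=
  forall (S : finType) (lev : S -> nat) (q : S -> R) (N : nat),
    (forall s, 0 <= q s) -> \sum_s q s = 1 -> (forall s, (lev s <= N)%N) ->
    (N <= 2 * n)%N ->
    (forall j, n%:R * level_mass lev q j <= eta * Num.sqrt n%:R) ->
    `|expect q (fun c : {ffun 'I_n -> S} => (stays lev q y c N)%:R) -
      two_sided_series (kolmogorov_term y)| <= eps / 2.
have [eta1 eta10 G1] : exists2 eta1, 0 < eta1 & \forall n \near \oo, good eta1 (x - d') n.
  exact: kolmogorov_uniform.
have [eta2 eta20 G2] : exists2 eta2, 0 < eta2 & \forall n \near \oo, good eta2 (x + d') n.
  exact: kolmogorov_uniform.
pose eta := Num.min eta1 eta2.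
have eta0 : 0 < eta by rewrite lt_min eta10.
have etale1 : eta <= eta1 by rewrite ge_min lexx.
have etale2 : eta <= eta2 by rewrite ge_min lexx orbT.
(* [eta / 4] controls the errors at the two ends of a cell, [d' / 2] the change of centring. *)
exists (Num.min (eta / 4) (d' / 2)); first by rewrite lt_min !divr_gt0.
set delta := Num.min _ _.
have de : delta <= eta / 4 by rewrite ge_min lexx.
have dd : delta <= d' / 2 by rewrite ge_min lexx orbT.
near=> n.
have r1 : 1 <= Num.sqrt (n%:R : R) by near: n; exact: near_sqrt.
have r2 : 2 / eta <= Num.sqrt (n%:R : R) by near: n; exact: near_sqrt.
have r3 : 2 / d' <= Num.sqrt (n%:R : R) by near: n; exact: near_sqrt.
have U1 : good eta1 (x - d') n by near: n.
have U2 : good eta2 (x + d') n by near: n.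
move: r1 r2 r3 U1 U2; set r := Num.sqrt n%:R => r1 r2 r3 U1 U2.
move=> d T P V V0 Y mV mV0 indep ident YG close.
have [Y0 YN Yh FY] := YG.
have r0 : 0 < r by exact: lt_le_trans r1.
have rr : r * r = n%:R by rewrite -expr2 sqr_sqrtr.
have n0 : (0 < n)%N by rewrite -(@ltr0n R) -rr mulr_gt0.
have nE : n%:R^-1 = r^-1 * r^-1 by rewrite -rr invfM.
pose lev (s : 'I_n.+2) : nat := s.
pose q := level_weight P V0 Y (N := n).
have q0 s : 0 <= q s by exact: level_weight_ge0.
have q1 : \sum_s q s = 1 by exact: level_weight1.
(* Level [n + 1] collects the values outside [[0, 1]]; [stays] with bound [n.+1] tests exactly the
   grid points. *)
have levN s : (lev s <= n.+1)%N by exact: (ltn_ord s).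
have Nn : (n.+1 <= 2 * n)%N by rewrite mul2n -addnn -addn1 leq_add2l.
have pE j : (j <= n)%N -> level_cdf lev q j = fine (P (V0 @^-1` `[0, Y j])).
  by move=> jn; exact: level_weight_cdf.
have pF j : (j <= n)%N -> `|level_cdf lev q j - F (Y j)| <= delta / r.
  by move=> jn; rewrite pE// close.
have dr : n%:R * (delta / r) = delta * r by rewrite -rr; field; rewrite gt_eqF.
have r2' : 1 <= eta / 2 * r by move: r2; rewrite ler_pdivrMr//; clear; lra.
have r3' : 1 <= d' / 2 * r by move: r3; rewrite ler_pdivrMr//; clear; lra.
have er : delta * r <= eta / 4 * r by rewrite ler_wpM2r// ltW.
have er0 : 0 <= eta * r by rewrite mulr_ge0// ltW.
have mass j : n%:R * level_mass lev q j <= eta * r.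
  have nn : 0 <= n%:R :> R by [].
  have key u : u <= n%:R^-1 + (delta / r + delta / r) -> n%:R * u <= eta * r.
    move=> H; apply: le_trans (ler_wpM2l nn H) _.
    by rewrite !mulrDr dr mulfV ?pnatr_eq0 -?lt0n//; clear -r2' er er0; lra.
  have in0 : 0 <= n%:R^-1 :> R by rewrite invr_ge0.
  have dr0 : 0 <= delta / r by apply: le_trans (pF 0%N (leq0n _)).
  have [jn|nj] := leqP j n.+1; last first.
    rewrite /level_mass big_pred0 ?mulr0// => s.
    by apply/negP => /eqP sj; have := levN s; rewrite sj leqNgt nj.
  apply: key; case: j jn => [|j] jn.
    rewrite -level_cdf0; have := pF 0%N (leq0n _); rewrite FY// mul0r subr0.
    by rewrite ler_norml => /andP[_ a1]; clear -a1 in0 dr0; lra.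
  have -> : level_mass lev q j.+1 = level_cdf lev q j.+1 - level_cdf lev q j.
    by rewrite level_cdfS addrAC subrr add0r.
  have jn' : (j <= n)%N by [].
  have := pF j jn'; rewrite ler_norml => /andP[lo _].
  have [jlt|] := ltnP j n.
    have := pF j.+1 jlt; rewrite ler_norml => /andP[_ up].
    have := FY _ jlt; have := FY _ jn'; rewrite -natr1 mulrDl mul1r => f1 f2.
    by clear -f1 f2 up lo; lra.
  (* The overflow level has mass at most [delta / r], since [F (Y n) = 1]. *)
  move=> nj; have jE : j = n by apply/eqP; rewrite eqn_leq jn' nj.
  rewrite jE in lo *; have := FY n (leqnn n); rewrite divff ?pnatr_eq0 -?lt0n// => f1.
  by have := level_cdf_le1 lev q0 q1 n.+1; clear -f1 lo in0 dr0; lra.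
have mass1 j : n%:R * level_mass lev q j <= eta1 * r.
  by apply: le_trans (mass j) _; rewrite ler_wpM2r// ltW.
have mass2 j : n%:R * level_mass lev q j <= eta2 * r.
  by apply: le_trans (mass j) _; rewrite ler_wpM2r// ltW.
have {}U1 := U1 _ lev q n.+1 q0 q1 levN Nn mass1.
have {}U2 := U2 _ lev q n.+1 q0 q1 levN Nn mass2.
pose c w := [ffun i => grid_level n Y (V i w)].
pose E x' := [set w | stays lev q x' (c w) n.+1].
have PE x' : fine (P (E x')) =
    expect q (fun c : {ffun 'I_n -> 'I_n.+2} => (stays lev q x' c n.+1)%:R).
  by rewrite /E (prob_levels mV mV0 indep ident Yh (fun c => stays lev q x' c n.+1)).
have mE x' : measurable (E x').
  exact: (measurable_levels mV Yh (fun c => stays lev q x' c n.+1)).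
set A := [set w | _ <= x].
have gh w u v : 0 <= u -> u <= v -> v <= 1 ->
    empirical_cdf (V ^~ w) u <= empirical_cdf (V ^~ w) v.
  by move=> _ uv _; exact: empirical_cdf_homo.
have mA : measurable A.
  apply: (measurable_sup01_le (g := fun w => empirical_cdf (V ^~ w)) Fc Fh F0 F1 (ltW r0) gh).
  move=> y _; rewrite /empirical_cdf; apply: measurable_funM => //.
  apply: measurable_sum => i.
  apply: measurableT_comp (mV i); exact: measurable_indic.
have devE w j : (j <= n)%N ->
    deviation lev q (c w) j = r * (empirical_cdf (V ^~ w) (Y j) - level_cdf lev q j).
  move=> jn; rewrite (empirical_cdf_level _ Yh jn) /deviation -/r -/(c w) nE -rr.
  by field; rewrite gt_eqF.
have cl j : (j <= n)%N -> `|r * (level_cdf lev q j - F (Y j))| <= d' / 2.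
  move=> jn; rewrite normrM gtr0_norm//; apply: le_trans dd.
  by rewrite mulrC -ler_pdivlMr// pF.
have AE : A `<=` E (x + d').
  move=> w /= Aw; apply/staysP => j; rewrite ltnS => jn; rewrite devE//.
  have Y01 : 0 <= Y j <= 1.
    by apply/andP; split; [rewrite -Y0|rewrite -YN]; apply: Yh; rewrite ?jn ?leqnn.
  have H := le_trans (le_sup01 Fh F0 F1 (ltW r0) (gh w) Y01) Aw.
  have := cl j jn; move: H; rewrite !ler_norml; clear => /andP[? ?] /andP[? ?].
  by apply/andP; split; lra.
(* One half of the margin [d'] pays for the change of centring, the other for the mesh of the
   grid. *)
have EA : E (x - d') `<=` A.
  move=> w /= /staysP st.
  have H j : (j <= n)%N -> `|r * (empirical_cdf (V ^~ w) (Y j) - F (Y j))| <= x - d' / 2.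
    move=> jn; have := st j jn; rewrite devE//.
    have := cl j jn; rewrite !ler_norml => /andP[a1 a2] /andP[b1 b2].
    by clear -a1 a2 b1 b2; apply/andP; split; lra.
  apply: le_trans (sup01_le_grid Fh (ltW r0) (gh w) n0 YG H) _.
  have : r / n%:R <= d' / 2.
    by rewrite nE mulrA mulfV ?gt_eqF// mul1r -[leLHS]mul1r ler_pdivrMr.
  by clear; lra.
have finP (B : set T) : measurable B -> P B \is a fin_num by move=> mB; exact: fin_num_measure.
have l1 : fine (P (E (x - d'))) <= fine (P A).
  by rewrite fine_le ?finP// le_measure ?inE.
have l2 : fine (P A) <= fine (P (E (x + d'))).
  by rewrite fine_le ?finP// le_measure ?inE.
have k1 : `|two_sided_series (kolmogorov_term (x - d')) -
   two_sided_series (kolmogorov_term x)| <= eps / 2.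
  by apply: Kc; rewrite addrAC subrr add0r normrN gtr0_norm.
have k2 : `|two_sided_series (kolmogorov_term (x + d')) -
   two_sided_series (kolmogorov_term x)| <= eps / 2.
  by apply: Kc; rewrite addrAC subrr add0r gtr0_norm.
move: U1 U2 k1 k2 l1 l2; rewrite !PE.
set z1 := two_sided_series _; set z2 := two_sided_series _; set z3 := two_sided_series _.
rewrite !ler_norml; clear => /andP[? ?] /andP[? ?] /andP[? ?] /andP[? ?] ? ?.
by apply/andP; split; lra.
Unshelve. all: end_near. Qed.

(** From single paths to the product space: off [bad] the integrand is within [e] of [kappa], and
    [bad] costs at most another [e] because [phi] takes values in [[0, 1]]. *)
Lemma integral_near_cst d (T : measurableType d) (R : realType) (P : probability T R)
    (phi : T -> \bar R) (bad : set T) (kappa e : R) :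
  measurable_fun setT phi -> (forall w, 0 <= phi w <= 1)%E -> measurable bad ->
  (P bad <= e%:E)%E -> 0 < e -> e < 1 ->
  (forall w, ~ bad w -> `|fine (phi w) - kappa| <= e) ->
  (\int[P]_w phi w)%E \is a fin_num /\ `|fine (\int[P]_w phi w)%E - kappa| <= 2 * e.
Proof.
move=> mphi phi01 mbad Pbad e0 e1 close.
have phi0 w : (0 <= phi w)%E by have /andP[] := phi01 w.
have phi1 w : (phi w <= 1)%E by have /andP[] := phi01 w.
have phif w : (phi w) = (fine (phi w))%:E.
  by rewrite fineK// ge0_fin_numE// (le_lt_trans (phi1 w))// ltry.
(* As [P bad < 1], a good point exists; it locates [kappa] within [e] of [[0, 1]], which makes the
   bounding integrands nonnegative. *)
have [w0 good0] : exists w, ~ bad w.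
  apply/not_existsP => H; have : bad = setT.
    by apply/seteqP; split => // w _; apply: contrapT; exact: H.
  by move=> badT; move: Pbad; rewrite badT probability_setT lee_fin leNgt e1.
have f0 w : 0 <= fine (phi w) by rewrite fine_ge0.
have f1 w : fine (phi w) <= 1 by rewrite -lee_fin -phif.
have := close w0 good0; rewrite ler_norml => /andP[k1 k2].
have ke0 : 0 <= kappa + e by have := f0 w0; lra.
have ke1 : kappa - e <= 1 by have := f1 w0; lra.
have m1 : measurable_fun setT (fun w => (\1_bad w)%:E : \bar R).
  by apply: measurableT_comp => //; exact: measurable_indic.
have i1 : (\int[P]_w (\1_bad w)%:E = P bad)%E by rewrite integral_indic// setIT.
have c1 (u : R) : (\int[P]_w u%:E = u%:E)%E.
  rewrite integral_cst// -[RHS]mule1; congr (_ * _)%E; exact: probability_setT.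
have ind0 w : 0 <= \1_bad w :> R by rewrite indicE.
have upper : (\int[P]_w phi w <= (kappa + e)%:E + P bad)%E.
  rewrite -i1 -(c1 (kappa + e)) -ge0_integralD//.
  apply: ge0_le_integral => //.
  - by apply: emeasurable_funD => //; exact: measurable_cst.
  - move=> w _; rewrite phif -EFinD lee_fin indicE.
    have [wb|wb] := boolP (w \in bad); rewrite /= ?mulr1n ?mulr0n; first by have := f1 w; lra.
    have := close w; rewrite -notin_setE => /(_ wb).
    by rewrite ler_norml => /andP[? ?]; lra.
have lower : ((kappa - e)%:E <= \int[P]_w phi w + P bad)%E.
  have [k0|k0] := leP (kappa - e) 0.
    by rewrite (@le_trans _ _ 0%E)// adde_ge0// integral_ge0.
  rewrite -i1 -(c1 (kappa - e)) -ge0_integralD//.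
  apply: ge0_le_integral => //.
  - by move=> w _; rewrite lee_fin ltW.
  - exact: emeasurable_funD.
  - move=> w _; rewrite phif -EFinD lee_fin indicE.
    have [wb|wb] := boolP (w \in bad); rewrite /= ?mulr1n ?mulr0n; first by have := f0 w; lra.
    have := close w; rewrite -notin_setE => /(_ wb).
    by rewrite ler_norml => /andP[? ?]; lra.
have I0 : (0 <= \int[P]_w phi w)%E by exact: integral_ge0.
have If : (\int[P]_w phi w)%E \is a fin_num.
  rewrite ge0_fin_numE// (le_lt_trans upper)// (@le_lt_trans _ _ ((kappa + e)%:E + e%:E)%E)//.
    by rewrite leeD2l.
  by rewrite -EFinD ltry.
split => //; move: upper lower Pbad.
have Pf : P bad \is a fin_num by exact: fin_num_measure.
rewrite -(fineK If) -(fineK Pf) -!EFinD !lee_fin => u l pb.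
by rewrite ler_norml; apply/andP; split; lra.
Qed.

Section cdf_values.
Context d (T : measurableType d) (R : realType) (P : probability T R) (X : {RV P >-> R}).
Hypothesis X01 : {ae P, forall w, 0 < X w < 1}.

Let null (A : set R) : measurable A -> (forall v, A v -> ~ (0 < v < 1)) ->
  P (X @^-1` A) = 0%E.
Proof.
move=> mA A01; have [N [mN PN sub]] := X01.
apply/eqP; rewrite eq_le measure_ge0 andbT -PN le_measure ?inE//.
  by rewrite -[X in measurable X]setTI; exact: measurable_funP.
by move=> w Aw; apply: sub => /=; exact: A01.
Qed.

Lemma cdf_at0 : cdf X 0 = 0%E.
Proof.
apply: null => // v /=; rewrite in_itv/= => v0 /andP[v1 _].
by move: v0; rewrite leNgt v1.
Qed.

Lemma cdf_at1 : cdf X 1 = 1%E.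
Proof.
have : ccdf X 1 = 0%E.
  apply: null => // v /=; rewrite in_itv/= andbT => v0 /andP[_ v1].
  by move: v0; rewrite ltNge ltW.
by rewrite cdf_1_ccdf => ->; rewrite sube0.
Qed.

End cdf_values.

(** * Sampling a random field *)

Section sampling.
Context (R : realType) (m : nat) (dX dtau : measure_display)
  (OmegaX : measurableType dX) (PX : probability OmegaX R)
  (Omegatau : measurableType dtau) (Ptau : probability Omegatau R)
  (X : m.-tuple R -> {RV PX >-> R}) (D : set (m.-tuple R)).
Hypotheses (mX : jointly_measurable X) (mD : measurable D).

Lemma measurable_path w : measurable_fun setT (fun t => X t w).
Proof. exact: (measurable_fun_pair1 w mX). Qed.

Lemma measurable_sample (Z : {RV Ptau >-> (m.-tuple R)}) :
  measurable_fun setT (fun p : OmegaX * Omegatau => X (Z p.2) p.1).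
Proof.
have mZ : measurable_fun setT (fun p : OmegaX * Omegatau => (Z p.2, p.1)).
  apply: measurable_fun_pair; last exact: measurable_fst.
  exact: measurableT_comp measurable_snd.
exact: (measurableT_comp mX mZ).
Qed.

(** [fine] sends an infinite measure to [0], whose inverse is [0], so the distribution would have
    total mass [0] instead of [1]. *)
Lemma uniform_finite (Z : {RV Ptau >-> (m.-tuple R)}) :
  uniformly_distributed D Z -> lebesgue_tuple R m D \is a fin_num.
Proof.
move=> /(_ setT measurableT); rewrite setTI /distribution /pushforward preimage_setT.
rewrite probability_setT; case: (lebesgue_tuple R m D) => [r||]//=.
  by rewrite invr0 mul0e => /eqP; rewrite onee_eq0.
by rewrite invr0 mul0e => /eqP; rewrite onee_eq0.
Qed.

(** Both sides measure the preimage of [A] along the path. With [A = [0, y]] this makes [Mn] the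
    conditional distribution function of a sampled value given the path. *)
Lemma spatial_average_uniform (Z : {RV Ptau >-> (m.-tuple R)}) (w : OmegaX) (A : set R) :
  uniformly_distributed D Z -> measurable A ->
  spatial_average D (fun s => \1_A (X s w)) = fine (Ptau [set v | A (X (Z v) w)]).
Proof.
move=> unifZ mA; have Dfin := uniform_finite unifZ.
have mB : measurable ((fun s => X s w) @^-1` A).
  by rewrite -[X in measurable X]setTI; exact: measurable_path.
have := unifZ _ mB; rewrite /distribution /pushforward.
rewrite [X in Ptau X](_ : _ = [set v | A (X (Z v) w)])// => ->.
rewrite fineM//; last first.
  rewrite ge0_fin_numE ?measure_ge0//; apply: le_lt_trans (_ : _ <= lebesgue_tuple R m D)%E _.
    by rewrite le_measure ?inE//; exact: measurableI.
  by rewrite -ge0_fin_numE// measure_ge0.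
by rewrite /spatial_average; congr (_ * _); rewrite /Rintegral -integral_indic.
Qed.

(** The average is the [Ptau]-measure of the sections of a measurable subset of the product
    space. *)
Lemma measurable_spatial_average (Z : {RV Ptau >-> (m.-tuple R)}) (A : set R) :
  uniformly_distributed D Z -> measurable A ->
  measurable_fun setT (fun w => spatial_average D (fun s => \1_A (X s w))).
Proof.
move=> unifZ mA; pose B := [set p : OmegaX * Omegatau | A (X (Z p.2) p.1)].
have mB : measurable B by rewrite -[B]setTI; exact: measurable_sample.
have -> : (fun w => spatial_average D (fun s => \1_A (X s w))) =
    fine \o (Ptau \o xsection B).
  apply/funext => w /=; rewrite (spatial_average_uniform w unifZ mA); congr (fine (Ptau _)).
  by apply/seteqP; split => v /=; rewrite /xsection /B /= in_setE.
by apply: measurableT_comp => //; exact: measurable_fun_xsection.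
Qed.

End sampling.

Theorem corollary7 (R : realType) (m : nat)
    (dX : measure_display) (OmegaX : measurableType dX)
    (PX : probability OmegaX R)
    (dtau : measure_display) (Omegatau : measurableType dtau)
    (Ptau : probability Omegatau R)
    (X : m.-tuple R -> {RV PX >-> R})
    (T : nat -> set (m.-tuple R)) (k : nat -> nat)
    (tau : forall n, 'I_(k n) -> {RV Ptau >-> (m.-tuple R)})
    (F : R -> R) (Fn : nat -> OmegaX -> Omegatau -> R -> R)
    (Mn : nat -> OmegaX -> R -> R) :
  jointly_measurable X -> homogeneous X -> ergodic X ->
  (forall t, {ae PX, forall w, 0 < X t w < 1}) ->
  (forall y, F y = fine (cdf (X (tuple_zero R m)) y)) ->
  continuous F ->
  pointwise_averaging T ->
  {homo k : i j / (i <= j)%N} -> k n @[n --> \oo] --> \oo ->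
  (forall n, mutually_independent (tau n)) ->
  (forall n i, uniformly_distributed (T n) (tau n i)) ->
  (forall n w v y, Fn n w v y = empirical_cdf (fun i => X (tau n i v) w) y) ->
  (forall n w y,
     Mn n w y = spatial_average (T n) (fun s => \1_(`[0, y]%classic) (X s w))) ->
  cvg_to_zero_in_probability PX (fun n w =>
    Num.sqrt (k n)%:R * sup01 (fun y => `|Mn n w y - F y|)) ->
  forall x : R, 0 < x ->
    (PX \x Ptau)%E [set wv : OmegaX * Omegatau |
      sup01 (fun y => `|Num.sqrt (k n)%:R * (Fn n wv.1 wv.2 y - F y)|) <= x]
      @[n --> \oo] -->
    (two_sided_series (fun j : int =>
      (-1) ^ j * expR (- (2 * j%:~R ^+ 2 * x ^+ 2))))%:E.
Proof.
move=> mX _ _ X01 FE Fc [Tbm _ _ _] _ kcvg ind unif FnE MnE Mcvg x x0.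
rewrite -[two_sided_series _]/(two_sided_series (kolmogorov_term x)).
set kappa := two_sided_series _.
have Fh : {homo F : y z / y <= z}.
  move=> y z yz; rewrite !FE fine_le ?fin_num_measure//; exact: cdf_nondecreasing.
have F0 : F 0 = 0 by rewrite FE (cdf_at0 (X01 _)).
have F1 : F 1 = 1 by rewrite FE (cdf_at1 (X01 _)).
pose A n := [set wv : OmegaX * Omegatau |
  sup01 (fun y => `|Num.sqrt (k n)%:R * (Fn n wv.1 wv.2 y - F y)|) <= x].
have mFn n y : measurable_fun setT (fun wv : OmegaX * Omegatau => Fn n wv.1 wv.2 y).
  rewrite (_ : (fun _ => _) = (fun wv : OmegaX * Omegatau =>
      empirical_cdf (fun i => X (tau n i wv.2) wv.1) y)); last first.
    by apply/funext => wv; rewrite FnE.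
  apply: measurable_funM => //; apply: measurable_sum => i.
  by apply: measurableT_comp (measurable_sample mX (tau n i)); exact: measurable_indic.
have mA n : measurable (A n).
  apply: (@measurable_sup01_le _ _ _ F (fun wv => Fn n wv.1 wv.2)) => //.
    by move=> wv y z _ yz _; rewrite !FnE; exact: empirical_cdf_homo.
have kappaP (e : R) : 0 < e -> e < 1 -> \forall n \near \oo,
    (PX \x Ptau)%E (A n) \is a fin_num /\ `|fine ((PX \x Ptau)%E (A n)) - kappa| <= 2 * e.
  move=> e0 e1; have [delta delta0 H] := kolmogorov_iid Fc Fh F0 F1 x0 e0.
  have kpos : \forall n \near \oo, (0 < k n)%N by exact: (kcvg _ (nbhs_infty_gt 0)).
  have Hk := kcvg _ H.
  (* [delta] is the tolerance of [kolmogorov_iid], which therefore applies to every path outside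
     [bad n]. *)
  pose bad n := [set w | delta <= `|Num.sqrt (k n)%:R * sup01 (fun y => `|Mn n w y - F y|)|].
  have Pbad : \forall n \near \oo, (PX (bad n) <= e%:E)%E.
    have /fine_cvgP[fin /cvgrPdist_le/(_ _ e0) near0] := Mcvg delta delta0.
    near=> n; have Pf : PX (bad n) \is a fin_num by near: n.
    rewrite -(fineK Pf) lee_fin.
    have : `|0 - fine (PX (bad n))| <= e by near: n.
    by rewrite sub0r normrN; apply: le_trans; exact: ler_norm.
  apply: filterS3 kpos Hk Pbad => n k0 Hn Pbadn.
  (* The first sample point represents the common law of all of them. *)
  pose i0 := Ordinal k0.
  have r0 : 0 < Num.sqrt (k n)%:R :> R by rewrite sqrtr_gt0 ltr0n.
  have mT : measurable (T n) by have [] := Tbm n.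
  have unif0 : uniformly_distributed (T n) (tau n i0) by exact: unif.
  have MnP w y : Mn n w y = fine (Ptau [set v | `[0, y]%classic (X (tau n i0 v) w)]).
    by rewrite MnE; exact: (spatial_average_uniform mX mT w unif0).
  have mV w i : measurable_fun setT (fun v => X (tau n i v) w).
    by apply: (measurableT_comp (measurable_path mX w)).
  have mV0 w y : measurable [set v | `[0, y]%classic (X (tau n i0 v) w)].
    by rewrite -[X in measurable X]setTI; exact: mV.
  have Mh w y z : 0 <= y -> y <= z -> z <= 1 -> Mn n w y <= Mn n w z.
    move=> _ yz _; rewrite !MnP fine_le ?fin_num_measure// le_measure ?inE// => v /=.
    by rewrite !in_itv/= => /andP[-> /le_trans]; apply.
  have mM y : measurable_fun setT (Mn n ^~ y).
    rewrite (_ : Mn n ^~ y = fun w => spatial_average (T n)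
      (fun s => \1_(`[0, y]%classic) (X s w))); last by apply/funext => w; exact: MnE.
    exact: (measurable_spatial_average mX mT unif0).
  have supE w : (fun y => `|Mn n w y - F y|) = (fun y => `|1 * (Mn n w y - F y)|).
    by apply/funext => y; rewrite mul1r.
  have badE : bad n = [set w | delta / Num.sqrt (k n)%:R <=
      sup01 (fun y => `|1 * (Mn n w y - F y)|)].
    apply/seteqP; split=> w /=; rewrite /bad/= supE.
      rewrite ger0_norm; first by rewrite ler_pdivrMr// mulrC.
      rewrite mulr_ge0// (le_trans _ (le_sup01 Fh F0 F1 ler01 (Mh w) (_ : 0 <= 0 <= 1)))//.
      by rewrite lexx ler01.
    by rewrite ler_pdivrMr// mulrC => /le_trans; apply; exact: ler_norm.
  have mbad : measurable (bad n).
    by rewrite badE; exact: (measurable_sup01_ge Fc Fh F0 F1 ler01 Mh (fun y _ => mM y)).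
  (* The product measure is the integral over paths of the measures of the sections. *)
  apply: (@integral_near_cst _ _ _ PX (Ptau \o xsection (A n)) (bad n)) => //.
  - exact: measurable_fun_xsection.
  - by move=> w /=; rewrite measure_ge0 probability_le1//; exact: measurable_xsection.
  move=> w good /=.
  have -> : xsection (A n) w = [set v | sup01 (fun y => `|Num.sqrt (k n)%:R *
      (empirical_cdf (fun i => X (tau n i v) w) y - F y)|) <= x].
    have FnE' v : (fun y => `|Num.sqrt (k n)%:R * (Fn n w v y - F y)|) = (fun y =>
        `|Num.sqrt (k n)%:R * (empirical_cdf (fun i => X (tau n i v) w) y - F y)|).
      by apply/funext => y; rewrite FnE.
    by apply/seteqP; split => v; rewrite /xsection/= in_setE /A/= FnE'.
  have [Y YG] := quantile_gridP Fc Fh F0 F1 k0.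
  apply: (Hn _ _ Ptau (fun i v => X (tau n i v) w) (fun v => X (tau n i0 v) w) Y) => //.
  - move=> B mB; have mB' i : measurable ((fun t => X t w) @^-1` B i).
      by rewrite -[X in measurable X]setTI; exact: measurable_path.
    have := ind n [set: 'I_(k n)]%SET _ mB'.
    rewrite (_ : [set` [set: 'I_(k n)]%SET] = setT); last first.
      by apply/seteqP; split => // i _ /=; rewrite finset.inE.
    by rewrite (eq_bigl xpredT) // => i; rewrite finset.inE.
  - move=> i B mB; have mB' : measurable ((fun t => X t w) @^-1` B).
      by rewrite -[X in measurable X]setTI; exact: measurable_path.
    by have := unif n i _ mB'; rewrite -(unif n i0 _ mB').
  - move=> j jk; rewrite -/(Mn n w (Y j)).
    have Y01 : 0 <= Y j <= 1.
      have [Y0 Yk Yh _] := YG.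
      by apply/andP; split; [rewrite -Y0|rewrite -Yk]; apply: Yh; rewrite ?jk ?leqnn.
    have := le_sup01 Fh F0 F1 ler01 (Mh w) Y01; rewrite mul1r MnP => /le_trans; apply.
    by move: good; rewrite badE /= => /negP; rewrite -ltNge => /ltW.
apply/fine_cvgP; split.
  have := kappaP 2^-1; rewrite invr_gt0 ltr0n invf_lt1// ltr1n => /(_ isT isT).
  by apply: filterS => n [].
apply/cvgrPdist_le => e e0.
pose e' := Num.min (e / 2) 2^-1.
have e'0 : 0 < e' by rewrite lt_min divr_gt0//= invr_gt0.
have e'1 : e' < 1 by rewrite gt_min invf_lt1// ltr1n orbT.
have e'e : 2 * e' <= e by rewrite mulrC -ler_pdivlMr// ge_min lexx.
have := kappaP e' e'0 e'1; apply: filterS => n [_] H.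
by rewrite distrC (le_trans H).
Unshelve. all: end_near. Qed.
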